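(* Let $K$ be a fixed finite simplicial complex with geometric realization $|K|$. Consider equations in the fixed list of operation symbols $F_i$ ($i\in\omega$), which contains each arity infinitely often. Then the set of finite sets $\Sigma$ of such equations with $\lambda_{|K|}(\Sigma)=0$ is a $\Pi_2$-set (in the arithmetical hierarchy).
   Context: Equations and $\lambda$. Terms are built from variables $x_0,x_1,\dots$ and the operation symbols; an equation $\sigma\approx\tau$ is an ordered pair of terms. An algebra $\mathbf A=(A;\overline F_i)$ has operations $\overline F_i:A^{n_i}\to A$; each term $\sigma$ yields a term operation $\sigma^{\mathbf A}:A^\omega\to A$. For a nonempty metric space $(A,d)$ put $\lambda_{\mathbf A}(\Sigma)=\sup\{d(\sigma^{\mathbf A}(\mathbf a),\tau^{\mathbf A}(\mathbf a)):\sigma\approx\tau\in\Sigma,\ \mathbf a\in A^\omega\}$ (sup of the empty set is $0$), and $\lambda_A(\Sigma)=\inf\lambda_{\mathbf A}(\Sigma)$ over all algebras $\mathbf A$ on $A$ whose operations are continuous. The list $F_i$ ($i\in\omega$) of operation symbols has a recursive arity function $i\mapsto n_i$, and every arity occurs infinitely often; finite sets of equations in these symbols are coded by natural numbers in a standard effective way. A finite simplicial complex $K$ is a finite family of nonempty finite sets closed under nonempty subsets, with vertex set $V=\bigcup K$; $|K|$ is the set of $\beta\in[0,1]^V$ with $\sum_v\beta_v=1$ and $\{v:\beta_v>0\}\in K$, with the Euclidean metric $d(\beta,\gamma)=\sqrt{\sum_v(\beta_v-\gamma_v)^2}$. *)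

(* Defs.v *)
From HB Require Import structures.
From mathcomp Require Import all_boot all_order all_algebra.
From mathcomp Require Import all_classical all_reals all_analysis.
From mathcomp Require Import ring.
Set Implicit Arguments.
Unset Strict Implicit.
Unset Printing Implicit Defensive.
Import Order.TTheory GRing.Theory Num.Theory.
Local Open Scope classical_set_scope.
Local Open Scope ring_scope.

(* The total recursive functions: the smallest class containing zero, successor
   and projections that is closed under composition, primitive recursion, and
   minimization of functions that have a zero at every parameter.  The last two
   rules specify the new function [h] by its defining (in)equations. *)
Inductive recursive : forall k : nat, (k.-tuple nat -> nat) -> Prop :=
| recursive_zero k : recursive (fun _ : k.-tuple nat => 0%N)
| recursive_succ : recursive (fun v : 1.-tuple nat => (thead v).+1)
| recursive_proj k (i : 'I_k) : recursive (fun v : k.-tuple nat => tnth v i)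
| recursive_comp k m (f : m.-tuple nat -> nat) (g : 'I_m -> k.-tuple nat -> nat) :
    recursive f -> (forall i, recursive (g i)) ->
    recursive (fun v : k.-tuple nat => f [tuple g i v | i < m])
| recursive_prim k (f : k.-tuple nat -> nat) (g : k.+2.-tuple nat -> nat)
    (h : k.+1.-tuple nat -> nat) :
    recursive f -> recursive g ->
    (forall v : k.-tuple nat, h [tuple of 0%N :: v] = f v) ->
    (forall n (v : k.-tuple nat),
       h [tuple of n.+1 :: v] = g [tuple of n :: h [tuple of n :: v] :: v]) ->
    recursive h
| recursive_min k (f : k.+1.-tuple nat -> nat) (h : k.-tuple nat -> nat) :
    recursive f ->
    (forall v : k.-tuple nat, f [tuple of h v :: v] = 0%N) ->
    (forall (v : k.-tuple nat) y, (y < h v)%N -> f [tuple of y :: v] <> 0%N) ->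
    recursive h.

Definition recursive_rel (k : nat) (P : pred (k.-tuple nat)) : Prop :=
  recursive (fun v : k.-tuple nat => nat_of_bool (P v)).

Definition Pi2 (S : set nat) : Prop :=
  exists P : pred (3.-tuple nat), recursive_rel P /\
    forall n, S n <-> forall x, exists y, P [tuple n; x; y].

(* [ar i] is the arity of the operation symbol F_i. *)
Inductive term (ar : nat -> nat) : Type :=
| Var of nat
| App (i : nat) of ('I_(ar i) -> term ar).

HB.instance Definition _ (ar : nat -> nat) := gen_eqMixin (term ar).
HB.instance Definition _ (ar : nat -> nat) := gen_choiceMixin (term ar).

Definition equation (ar : nat -> nat) : Type := (term ar * term ar)%type.

HB.instance Definition _ (ar : nat -> nat) := Choice.on (equation ar).

(* [CodeSeq.code] is an effective bijection from [seq nat] to [nat]. *)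
Fixpoint term_code (ar : nat -> nat) (s : term ar) : nat :=
  match s with
  | Var n => CodeSeq.code [:: 0%N; n]
  | App i args =>
      CodeSeq.code [:: 1%N, i & [seq term_code (args j) | j <- enum 'I_(ar i)]]
  end.

Definition equation_code (ar : nat -> nat) (e : equation ar) : nat :=
  CodeSeq.code [:: term_code e.1; term_code e.2].

(* The canonical index of a finite set: the k-th binary digit of the code of
   [Sigma] is 1 iff k is the code of an equation in [Sigma].  Not meaningful
   when [Sigma] is infinite. *)
Definition finset_code (ar : nat -> nat) (Sigma : set (equation ar)) : nat :=
  \sum_(e \in Sigma) (2 ^ equation_code e)%N.

Definition algebra (ar : nat -> nat) (A : Type) : Type :=
  forall i : nat, ('I_(ar i) -> A) -> A.

Fixpoint term_op (ar : nat -> nat) (A : Type) (F : algebra ar A) (s : term ar)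
    (a : nat -> A) : A :=
  match s with
  | Var n => a n
  | App i args => F i (fun j => term_op F (args j) a)
  end.

Definition continuous_algebra (ar : nat -> nat) (A : topologicalType)
    (F : algebra ar A) : Prop :=
  forall i, continuous (F i : {ptws 'I_(ar i) -> A} -> A).

(* The supremum is taken in [0, +oo], whence the added point 0: it only matters
   when the set of distances is empty. *)
Definition lambda_algebra (R : realType) (ar : nat -> nat) (A : metricType R)
    (F : algebra ar A) (Sigma : set (equation ar)) : \bar R :=
  ereal_sup ([set 0%E] `|`
    [set x | exists (e : equation ar) (a : nat -> A), Sigma e /\
       x = (mdist (term_op F e.1 a) (term_op F e.2 a))%:E]).

Definition lambda_space (R : realType) (ar : nat -> nat) (A : metricType R)
    (Sigma : set (equation ar)) : \bar R :=
  ereal_inf [set lambda_algebra F Sigma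
            | F in [set F : algebra ar A | continuous_algebra F]].

(* [V] is exactly the vertex set, i.e. the union of all simplices. *)
Record simplicial_complex (V : finType) := SimplicialComplex {
  simplices :> {set {set V}};
  simplices_neq0 : finset.set0 \notin simplices;
  simplices_sub : forall s t : {set V},
    s \in simplices -> t \subset s -> t != finset.set0 -> t \in simplices;
  simplices_cover : finset.cover simplices = [set: V]%SET }.

Definition in_realization (R : realType) (V : finType)
    (K : simplicial_complex V) (b : {ffun V -> R}) : bool :=
  [&& [forall v, (0 <= b v <= 1)], \sum_v b v == 1
    & [set v | 0 < b v]%SET \in simplices K].

Record realization (R : realType) (V : finType) (K : simplicial_complex V) :=
  Realization {
    coords :> {ffun V -> R};
    _ : in_realization K coords }.

HB.instance Definition _ (R : realType) (V : finType)
  (K : simplicial_complex V) := [isSub for @coords R V K].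
HB.instance Definition _ (R : realType) (V : finType)
  (K : simplicial_complex V) := [Choice of realization R K by <:].

Section euclidean_distance.
Context (R : realType) (V : finType) (K : simplicial_complex V).
Implicit Types x y z : realization R K.

Definition eucl_dist x y : R := Num.sqrt (\sum_v (x v - y v) ^+ 2).

Lemma eucl_distxx x : eucl_dist x x = 0.
Proof.
by rewrite /eucl_dist big1 ?sqrtr0// => v _; rewrite subrr expr0n.
Qed.

Lemma eucl_dist_positivity x y : eucl_dist x y = 0 -> x = y.
Proof.
move=> /eqP; rewrite sqrtr_eq0 => le0.
have : \sum_v (x v - y v) ^+ 2 == 0.
  by rewrite eq_le le0 sumr_ge0// => v _; rewrite sqr_ge0.
rewrite psumr_eq0 => [|v _]; last exact: sqr_ge0.
move=> /allP xy0; apply: val_inj; apply/ffunP => v.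
have := xy0 v (mem_index_enum v).
by rewrite /= sqrf_eq0 subr_eq0 => /eqP.
Qed.

Lemma eucl_dist_sym x y : eucl_dist x y = eucl_dist y x.
Proof.
by rewrite /eucl_dist; congr Num.sqrt; apply: eq_bigr => v _; rewrite -sqrrN opprB.
Qed.

Lemma cauchy_schwarz (a b : V -> R) :
  (\sum_v a v * b v) ^+ 2 <= (\sum_v a v ^+ 2) * (\sum_v b v ^+ 2).
Proof.
have sumE c d : \sum_v (c * a v - d * b v) ^+ 2 =
    c ^+ 2 * (\sum_v a v ^+ 2) - (2 * c * d) * (\sum_v a v * b v)
    + d ^+ 2 * (\sum_v b v ^+ 2).
  by rewrite !mulr_sumr -sumrB -big_split/=; apply: eq_bigr => v _; ring.
set p := \sum_v a v * b v in sumE *; set A := \sum_v a v ^+ 2 in sumE *.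
set B := \sum_v b v ^+ 2 in sumE *.
have B0 : 0 <= B by rewrite sumr_ge0// => v _; rewrite sqr_ge0.
have key : 0 <= B * (A * B - p ^+ 2).
  suff -> : B * (A * B - p ^+ 2) = \sum_v (B * a v - p * b v) ^+ 2.
    by rewrite sumr_ge0// => v _; rewrite sqr_ge0.
  by rewrite sumE; ring.
move: B0; rewrite le_eqVlt => /predU1P[B0|B0]; last first.
  by move: key; rewrite pmulr_rge0// subr_ge0.
have b0 v : b v = 0.
  have /eqP := esym B0; rewrite psumr_eq0 => [/allP/(_ v (mem_index_enum v))|w _].
    by rewrite /= sqrf_eq0 => /eqP.
  exact: sqr_ge0.
by rewrite -B0 mulr0 /p big1 ?expr0n// => v _; rewrite b0 mulr0.
Qed.

Lemma eucl_dist_triangle y x z :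
  eucl_dist x z <= eucl_dist x y + eucl_dist y z.
Proof.
rewrite /eucl_dist.
set a := fun v => x v - y v; set b := fun v => y v - z v.
rewrite -[\sum_v (x v - y v) ^+ 2]/(\sum_v a v ^+ 2).
rewrite -[\sum_v (y v - z v) ^+ 2]/(\sum_v b v ^+ 2).
have -> : \sum_v (x v - z v) ^+ 2 =
    \sum_v a v ^+ 2 + (\sum_v a v * b v) *+ 2 + \sum_v b v ^+ 2.
  rewrite -sumrMnl -!big_split/=; apply: eq_bigr => v _.
  by rewrite -sqrrD /a /b addrA subrK.
have A0 : 0 <= \sum_v a v ^+ 2 by rewrite sumr_ge0// => v _; rewrite sqr_ge0.
have B0 : 0 <= \sum_v b v ^+ 2 by rewrite sumr_ge0// => v _; rewrite sqr_ge0.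
rewrite -[leRHS]ger0_norm ?addr_ge0 ?sqrtr_ge0// -sqrtr_sqr.
apply: ler_wsqrtr; rewrite sqrrD !sqr_sqrtr// lerD2r lerD2l lerMn2r/=.
rewrite -sqrtrM//; apply: (le_trans (ler_norm _)).
by rewrite -sqrtr_sqr; apply: ler_wsqrtr; exact: cauchy_schwarz.
Qed.

End euclidean_distance.

HB.instance Definition _ (R : realType) (V : finType)
    (K : simplicial_complex V) :=
  @isMetric.Build R (realization R K) (@eucl_dist R V K)
    (@eucl_distxx R V K) (@eucl_dist_positivity R V K)
    (@eucl_dist_sym R V K) (@eucl_dist_triangle R V K).

(* Main.v *)
Require Import Defs.
From HB Require Import structures.
From mathcomp Require Import all_boot all_order all_algebra.
From mathcomp Require Import all_classical all_reals all_analysis.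
From mathcomp Require Import zify ring lra.
Set Implicit Arguments.
Unset Strict Implicit.
Unset Printing Implicit Defensive.

(* A continuous operation on |K| is recorded, up to a small error, by its values
   on the points of |K| whose coordinates are multiples of 1/M.  Conversely a
   table f on such grid points that varies slowly is interpolated by a continuous
   operation: take a partition of unity psi_g subordinate to balls around the grid
   tuples g and normalize sum_g psi_g(y) max(f(g) - delta, 0), where delta bounds
   the variation of f on overlapping balls.  If two values of f differ by at most
   delta, then after subtracting delta the support of one lies in the support of
   the other, so the normalized sum stays in |K|; no triangulation of the product
   is needed.  With a chain of moduli A_0 <= A_1 <= ..., where inputs within
   2 A_j of each other have values within A_{j+1}, the error on a term is
   controlled by its depth (here crudely bounded by its code).  Hence lambda = 0
   iff for every x there are M, a table and a chain of moduli passing a finite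
   check at precision 1/(x+1), and that check is recursive. *)

(** * Recursive functions of an environment *)

(** The number n coding Sigma bounds everything the check runs over. A list code exceeds every
    entry, so all symbol indices, variable indices and codes of terms and equations occurring in
    Sigma lie below n. Hence the check only inspects symbols F_i with i < n, assignments of n
    variables and moduli A_0, ..., A_n, and A_j may be attached to terms of code j.

    Decidability forces exact integer inequalities, so the two directions meet only up to constant
    factors. A passed check yields an algebra with coordinatewise error 3/(x+1), whereas the
    completeness direction starts from an algebra with error below 1/(4(x+1)) to have room for
    rounding. This is harmless because x ranges over all naturals. The moduli are chosen downwards,
    from A_n given by the precision to A_0 given by uniform continuity; only then is M taken large
    compared with everything else.

    The complex without vertices is treated apart: its realization is empty and carries no algebra,
    because some symbol is nullary. *)

Definition recN (f : seq nat -> nat) := forall k, recursive (fun v : k.-tuple nat => f v).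
Definition recB (f : seq nat -> bool) := recN (fun e => nat_of_bool (f e)).
Definition recS (f : seq nat -> seq nat) := recN (fun e => CodeSeq.code (f e)).
(** The only changes of environment besides adding an entry in front are those that skip bound
    variables. *)
Definition recE (f : seq nat -> seq nat) := exists k, f = drop k.

Lemma recursive_ext k (f g : k.-tuple nat -> nat) : f =1 g -> recursive f -> recursive g.
Proof. by move=> /funext ->. Qed.

Lemma recN_ext f g : f =1 g -> recN f -> recN g.
Proof. by move=> /funext ->. Qed.

Lemma recB_ext f g : f =1 g -> recB f -> recB g.
Proof. by move=> /funext ->. Qed.

(** A variable beyond the end of the environment reads as 0, so the closure rules need no side
    conditions on its length. *)
Lemma recN_nth i : recN (fun e => nth 0 e i).
Proof.
move=> k; case: (ltnP i k) => ik.
  by apply: recursive_ext (recursive_proj (Ordinal ik)) => v; rewrite (tnth_nth 0).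
by apply: recursive_ext (recursive_zero k) => v; rewrite nth_default // size_tuple.
Qed.

Lemma recE_id : recE (fun e => e).
Proof. by exists 0; apply/funext => e; rewrite drop0. Qed.

Lemma recE_drop k f : recE f -> recE (fun e => drop k (f e)).
Proof. by case=> m ->; exists (k + m); apply/funext => e; rewrite drop_drop. Qed.

Lemma recN_var f i : recE f -> recN (fun e => nth 0 (f e) i).
Proof.
case=> k ->; apply: recN_ext (recN_nth (k + i)) => e.
by rewrite nth_drop.
Qed.

Lemma recN_comp m (g : m.-tuple nat -> nat) (fs : 'I_m -> seq nat -> nat) :
  recursive g -> (forall i, recN (fs i)) ->
  recN (fun e => g [tuple fs i e | i < m]).
Proof. by move=> rg rfs k; apply: (recursive_comp rg) => i; apply: rfs. Qed.

Lemma recN_fun1 (g : nat -> nat) f :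
  recursive (fun v : 1.-tuple nat => g (thead v)) -> recN f -> recN (fun e => g (f e)).
Proof.
move=> rg rf; apply: recN_ext (recN_comp (fs := fun=> f) rg (fun=> rf)) => e.
by rewrite /thead tnth_mktuple.
Qed.

Lemma recN_S f : recN f -> recN (fun e => (f e).+1).
Proof. exact: (recN_fun1 recursive_succ). Qed.

Lemma recN_const c : recN (fun=> c).
Proof. by elim: c => [k|c IH]; [exact: recursive_zero | exact: recN_S]. Qed.

Lemma recN_cons q f h : recN q -> recN f -> recE h -> recN (fun e => q (f e :: h e)).
Proof.
move=> rq rf [j ->] k.
have lt (i : 'I_(k - j)) : j + i < k by have := ltn_ord i; lia.
(* Entry 0 of the new tuple is [f]; entry i'.+1 is the projection onto variable j + i'. *)
pose fs (i : 'I_(k - j).+1) : k.-tuple nat -> nat :=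
  if unlift ord0 i is Some i' then fun v => tnth v (Ordinal (lt i')) else fun v => f v.
have rfs i : recursive (fs i).
  by rewrite /fs; case: unliftP => [i' _|_]; [exact: recursive_proj | exact: rf].
apply: recursive_ext (recursive_comp (rq _) rfs) => v.
congr q; apply: (@eq_from_nth _ 0) => [|i]; rewrite size_tuple /= ?size_drop ?size_tuple// => ik.
rewrite (nth_map (Ordinal ik)) ?size_enum_ord// /fs.
case: unliftP => [i'|] /(f_equal val); rewrite /= nth_enum_ord// => ->//=.
by rewrite nth_drop (tnth_nth 0).
Qed.

(* The environment is extended by the value of [f], de Bruijn style. *)
Lemma recN_let (p : nat -> seq nat -> nat) f :
  recN (fun e => p (nth 0 e 0) (drop 1 e)) -> recN f -> recN (fun e => p (f e) e).
Proof.
move=> rp rf; apply: recN_ext (recN_cons rp rf recE_id) => e.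
by rewrite /= drop0.
Qed.

Lemma recN_natrec b (s : nat -> nat -> seq nat -> nat) n :
  recN b -> recN (fun e => s (nth 0 e 0) (nth 0 e 1) (drop 2 e)) -> recN n ->
  recN (fun e => nat_rec (fun=> nat) (b e) (fun m r => s m r e) (n e)).
Proof.
move=> rb rs rn.
(* [recursive_prim] recurses on the first entry of a tuple, so the bound is first turned into
   variable 0. In the empty environment that variable reads as 0 and the function is constant. *)
apply: (@recN_let (fun N e => nat_rec (fun=> nat) (b e) (fun m r => s m r e) N)) rn => -[|k].
  have := recN_const (nat_rec (fun=> nat) (b [::]) (fun m r => s m r [::]) 0) 0.
  by apply: recursive_ext => v; rewrite tuple0.
apply: (recursive_prim (rb k) (rs k.+2)) => [v|n0 v] /=; first by rewrite drop0.
by rewrite !drop0.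
Qed.

Lemma recN_min (p : nat -> seq nat -> nat) h :
  recN (fun e => p (nth 0 e 0) (drop 1 e)) ->
  (forall e, p (h e) e = 0) -> (forall e y, y < h e -> p y e <> 0) -> recN h.
Proof.
move=> rp h0 hmin k; apply: (recursive_min (rp k.+1)) => [v|v y] /=;
  rewrite drop0 //; exact: hmin.
Qed.

Lemma recN_shift f h : recN f -> recE h -> recN (fun e => f (h e)).
Proof.
move=> rf [k ->] m; case: (ltnP m k) => mk.
  by apply: recursive_ext (recN_const (f [::]) m) => v; rewrite drop_oversize ?size_tuple 1?ltnW.
have lt (i : 'I_(m - k)) : k + i < m by have := ltn_ord i; lia.
apply: recursive_ext (recursive_comp (rf (m - k)) (fun i =>
  recursive_proj (Ordinal (lt i)))) => v.
congr f; apply: (@eq_from_nth _ 0); rewrite ?size_tuple ?size_drop ?size_tuple// => i ik.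
by rewrite nth_drop (nth_map (Ordinal ik)) ?size_enum_ord// (tnth_nth 0) /= nth_enum_ord.
Qed.

Create HintDb rec.
#[local] Hint Resolve recE_id recE_drop recN_var recN_S recN_const : rec.
#[local] Hint Extern 1 (recN _) => match goal with
  | H : recN ?g |- recN (fun e => ?g (@?h e)) => apply: (recN_shift (h := h) H)
  end : rec.
#[local] Hint Extern 1 (recB _) => unfold recB : rec.
#[local] Hint Extern 1 (recS _) => unfold recS : rec.

Lemma recN_add f g : recN f -> recN g -> recN (fun e => f e + g e).
Proof.
move=> rf rg.
have E e : nat_rec (fun=> nat) (g e) (fun m r => r.+1) (f e) = f e + g e.
  by elim: (f e) => //= n ->.
by apply: (recN_ext E); apply: recN_natrec; auto 20 with rec.
Qed.
#[local] Hint Resolve recN_add : rec.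

Lemma recN_mul f g : recN f -> recN g -> recN (fun e => f e * g e).
Proof.
move=> rf rg.
have E e : nat_rec (fun=> nat) 0 (fun m r => g e + r) (f e) = f e * g e.
  by elim: (f e) => //= n ->; rewrite mulSn.
apply: (recN_ext E).
by apply: (@recN_natrec _ (fun m r e => g e + r)); auto 20 with rec.
Qed.
#[local] Hint Resolve recN_mul : rec.

Lemma recN_pred f : recN f -> recN (fun e => (f e).-1).
Proof.
move=> rf; have E e : nat_rec (fun=> nat) 0 (fun m r => m) (f e) = (f e).-1 by case: (f e).
by apply: (recN_ext E); apply: recN_natrec; auto 20 with rec.
Qed.
#[local] Hint Resolve recN_pred : rec.

Lemma recN_sub f g : recN f -> recN g -> recN (fun e => f e - g e).
Proof.
move=> rf rg.
have E e : nat_rec (fun=> nat) (f e) (fun m r => r.-1) (g e) = f e - g e.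
  by elim: (g e) => /= [|n ->]; rewrite ?subn0 ?subnS.
by apply: (recN_ext E); apply: recN_natrec; auto 20 with rec.
Qed.
#[local] Hint Resolve recN_sub : rec.

Lemma recN_exp f g : recN f -> recN g -> recN (fun e => f e ^ g e).
Proof.
move=> rf rg.
have E e : nat_rec (fun=> nat) 1 (fun m r => f e * r) (g e) = f e ^ g e.
  by elim: (g e) => //= n ->; rewrite expnS.
apply: (recN_ext E).
by apply: (@recN_natrec _ (fun m r e => f e * r)); auto 20 with rec.
Qed.
#[local] Hint Resolve recN_exp : rec.

Lemma recN_bool b : recB b -> recN (fun e => b e).
Proof. by []. Qed.

Lemma recB_neg b : recB b -> recB (fun e => ~~ b e).
Proof.
move=> rb; have E e : 1 - b e = ~~ b e by case: (b e).
by apply: (recN_ext E); auto 20 with rec.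
Qed.

Lemma recB_leq f g : recN f -> recN g -> recB (fun e => f e <= g e).
Proof.
move=> rf rg; have E e : 1 - (f e - g e) = (f e <= g e) by lia.
by apply: (recN_ext E); auto 20 with rec.
Qed.

Lemma recB_and a b : recB a -> recB b -> recB (fun e => a e && b e).
Proof.
move=> ra rb; have E e : a e * b e = (a e && b e) by case: (a e); case: (b e).
by apply: (recN_ext E); auto 20 with rec.
Qed.
#[local] Hint Resolve recN_bool recB_neg recB_leq recB_and : rec.

Lemma recB_or a b : recB a -> recB b -> recB (fun e => a e || b e).
Proof.
move=> ra rb; have E e : ~~ (~~ a e && ~~ b e) = (a e || b e) by rewrite negb_and !negbK.
by apply: (recB_ext E); auto 20 with rec.
Qed.
#[local] Hint Resolve recB_or : rec.

Lemma recB_imp a b : recB a -> recB b -> recB (fun e => a e ==> b e).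
Proof.
move=> ra rb; have E e : ~~ a e || b e = (a e ==> b e) by rewrite implybE.
by apply: (recB_ext E); auto 20 with rec.
Qed.

Lemma recB_eq f g : recN f -> recN g -> recB (fun e => f e == g e).
Proof.
move=> rf rg; have E e : (f e <= g e) && (g e <= f e) = (f e == g e) by lia.
by apply: (recB_ext E); auto 20 with rec.
Qed.
#[local] Hint Resolve recB_imp recB_eq : rec.

Lemma recN_if b f g : recB b -> recN f -> recN g -> recN (fun e => if b e then f e else g e).
Proof.
move=> rb rf rg; have E e : b e * f e + ~~ b e * g e = if b e then f e else g e.
  by case: (b e) => /=; lia.
by apply: (recN_ext E); auto 20 with rec.
Qed.

Lemma recB_all (p : nat -> seq nat -> bool) n :
  recB (fun e => p (nth 0 e 0) (drop 1 e)) -> recN n ->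
  recB (fun e => all (fun m => p m e) (iota 0 (n e))).
Proof.
move=> rp rn.
have E e : nat_rec (fun=> nat) 1 (fun m r => p m e * r) (n e) =
    all (fun m => p m e) (iota 0 (n e)).
  elim: (n e) => //= k ->; rewrite -[RHS]/(nat_of_bool (all (p^~ e) (iota 0 k.+1))) -addn1
    iotaD all_cat /=.
  by rewrite andbT andbC; case: (p k e); case: (all _ _).
apply: (recN_ext E).
apply: (@recN_natrec _ (fun m r e => p m e * r)); [by auto 20 with rec| |by []].
have rp2 : recB (fun e => p (nth 0 e 0) (drop 2 e)).
  have rh : recE (drop 2) by auto 20 with rec.
  by have := recN_cons rp (recN_nth 0) rh; apply: recN_ext => e; rewrite /= drop0.
by auto 20 with rec.
Qed.
#[local] Hint Extern 1 (recB (fun e => all (fun m => @?p m e) (iota 0 (@?n e)))) =>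
  apply: (@recB_all p n) : rec.

(** A function is recursive once it is the least solution of a recursive condition; later functions
    are characterized this way instead of being computed. *)
Lemma recN_minb (p : nat -> seq nat -> bool) h :
  recB (fun e => p (nth 0 e 0) (drop 1 e)) ->
  (forall e, p (h e) e) -> (forall e y, y < h e -> ~~ p y e) -> recN h.
Proof.
move=> rp h0 hmin; apply: (@recN_min (fun m e => ~~ p m e)).
- by auto 20 with rec.
- by move=> e; rewrite h0.
- by move=> e y /hmin ->.
Qed.

(** * Coded lists: the exponent of 2 in a code is the head, the odd part carries the tail *)

Lemma recN_code_cons f g : recN f -> recN g ->
  recN (fun e => 2 ^ f e * (g e).*2.+1).
Proof.
move=> rf rg; have E e : 2 ^ f e * (2 * g e).+1 = 2 ^ f e * (g e).*2.+1 by rewrite mul2n.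
by apply: (recN_ext E); auto 20 with rec.
Qed.
#[local] Hint Resolve recN_code_cons : rec.

Lemma recS_nil : recS (fun=> [::]).
Proof. exact: recN_const. Qed.

Lemma recS_cons f s : recN f -> recS s -> recS (fun e => f e :: s e).
Proof. exact: recN_code_cons. Qed.

Lemma recS_decode f : recN f -> recS (fun e => CodeSeq.decode (f e)).
Proof. by apply: recN_ext => e; rewrite CodeSeq.decodeK. Qed.

Lemma recN_code s : recS s -> recN (fun e => CodeSeq.code (s e)).
Proof. by []. Qed.
#[local] Hint Resolve recS_nil recS_cons recS_decode recN_code : rec.

Lemma code_nil_eq0 s : (CodeSeq.code s == 0) = (s == [::]).
Proof. by rewrite -(can_eq CodeSeq.codeK). Qed.

(** The head is the least exponent admitting an odd cofactor. The cofactor is determined by the code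
    of the tail, which is below the whole code, so that inner search is bounded. The disjunct for
    code 0 gives the empty list the head 0. *)
Lemma recN_head s : recS s -> recN (fun e => head 0 (s e)).
Proof.
move=> rs; pose c e := CodeSeq.code (s e).
have rc : recN c by exact: rs.
apply: (@recN_minb (fun m e => (c e == 0) ||
  ~~ all (fun r => ~~ (2 ^ m * r.*2.+1 == c e)) (iota 0 (c e)))); first by auto 10 with rec.
- move=> e; rewrite /c; case: (s e) => //= x t; apply/orP; right.
  apply/allPn; exists (CodeSeq.code t); rewrite ?negbK// mem_iota /=.
  by rewrite add0n -(prednK (expn_gt0 2 x)); nia.
- move=> e y; rewrite code_nil_eq0; case E : (s e) => [//|x t] /= yx.
  rewrite negbK; apply/allP => r _; apply/negP => /eqP.
  rewrite /c E -[LHS]/(2 ^ y * r.*2.+1) -[r]CodeSeq.decodeK.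
  move=> /(can_inj CodeSeq.codeK (x1 := y :: _) (x2 := x :: t)) [yx']; lia.
Qed.

Lemma recS_behead s : recS s -> recS (fun e => behead (s e)).
Proof.
move=> rs; pose c e := CodeSeq.code (s e).
have rc : recN c by exact: rs.
apply: (@recN_minb (fun m e => (c e == 0) ||
  ~~ all (fun r => ~~ (2 ^ r * m.*2.+1 == c e)) (iota 0 (c e)))); first by auto 10 with rec.
- move=> e; rewrite /c; case E : (s e) => [|x t] //=; apply/orP; right.
  apply/allPn; exists x; rewrite ?negbK// mem_iota /=.
  by rewrite add0n; have := ltn_expl x (isT : 1 < 2); nia.
- move=> e y; rewrite code_nil_eq0; case E : (s e) => [//|x t] /= yt.
  rewrite negbK; apply/allP => r _; apply/negP => /eqP.
  rewrite /c E -[LHS]/(2 ^ r * y.*2.+1) -[y]CodeSeq.decodeK.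
  move=> /(can_inj CodeSeq.codeK (x1 := r :: _) (x2 := x :: t)) [_ yx'].
  by rewrite -yx' CodeSeq.decodeK ltnn in yt.
Qed.
#[local] Hint Resolve recN_head recS_behead : rec.

Lemma recS_drop n s : recN n -> recS s -> recS (fun e => drop (n e) (s e)).
Proof.
move=> rn rs.
have E e : nat_rec (fun=> nat) (CodeSeq.code (s e))
    (fun m r => CodeSeq.code (behead (CodeSeq.decode r))) (n e) =
    CodeSeq.code (drop (n e) (s e)).
  elim: (n e) => /= [|m ->]; first by rewrite drop0.
  by rewrite CodeSeq.codeK -drop1 drop_drop.
by apply: (recN_ext E); apply: recN_natrec; auto 20 with rec.
Qed.
#[local] Hint Resolve recS_drop : rec.

Lemma recN_nthS s n : recS s -> recN n -> recN (fun e => nth 0 (s e) (n e)).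
Proof.
move=> rs rn; have E e : head 0 (drop (n e) (s e)) = nth 0 (s e) (n e).
  by rewrite -nth0 nth_drop addn0.
by apply: (recN_ext E); auto 20 with rec.
Qed.

Lemma recN_size s : recS s -> recN (fun e => size (s e)).
Proof.
move=> rs; apply: (@recN_minb (fun m e => CodeSeq.code (drop m (s e)) == 0)).
- have rs' : recS (fun e => s (drop 1 e)) by apply: (recN_shift rs); auto 20 with rec.
  by auto 20 with rec.
- by move=> e; rewrite drop_size.
- move=> e y ys; rewrite code_nil_eq0; apply/eqP => /(f_equal size).
  by rewrite size_drop /=; lia.
Qed.
#[local] Hint Resolve recN_nthS recN_size : rec.

Lemma recN_shiftn f n : recN f -> recN (fun e => f (drop n e)).
Proof. by move=> rf; apply: (recN_shift rf); auto 20 with rec. Qed.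

Lemma recN_let_shift (p : nat -> seq nat -> nat) f n :
  recN (fun e => p (nth 0 e 0) (drop 1 e)) -> recN f ->
  recN (fun e => p (f e) (drop n e)).
Proof.
move=> rp rf; have rh : recE (drop n) by auto 20 with rec.
by have := recN_cons rp rf rh; apply: recN_ext => e; rewrite /= drop0.
Qed.

Lemma recS_map (p : nat -> seq nat -> nat) s :
  recN (fun e => p (nth 0 e 0) (drop 1 e)) -> recS s ->
  recS (fun e => [seq p m e | m <- s e]).
Proof.
move=> rp rs; pose n e := size (s e).
have E e : nat_rec (fun=> nat) 0 (fun m r => CodeSeq.code
    (p (nth 0 (s e) (n e - m.+1)) e :: CodeSeq.decode r)) (n e) =
    CodeSeq.code [seq p m e | m <- s e].
  (* The list is built from its end: after m steps the accumulator codes the images of the last m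
     entries. *)
  suff H m : m <= n e -> nat_rec (fun=> nat) 0 (fun m r => CodeSeq.code
      (p (nth 0 (s e) (n e - m.+1)) e :: CodeSeq.decode r)) m =
      CodeSeq.code [seq p m e | m <- drop (n e - m) (s e)].
    by rewrite H// subnn drop0.
  elim: m => [_|m IH mn]; first by rewrite subn0 drop_size.
  rewrite [LHS]/= IH; last exact: ltnW.
  rewrite CodeSeq.codeK -(subnSK mn) [in RHS](drop_nth 0) //.
  by rewrite -/(n e) ltn_subrL /=; exact: leq_ltn_trans mn.
apply: (recN_ext E).
have rs2 : recS (fun e => s (drop 2 e)) by exact: (recN_shiftn 2 rs).
have rn : recN n by exact: recN_size.
have rn2 : recN (fun e => n (drop 2 e)) by exact: (recN_shiftn 2 rn).
apply: (@recN_natrec _ (fun m r e => CodeSeq.code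
    (p (nth 0 (s e) (n e - m.+1)) e :: CodeSeq.decode r))) => //; first by auto 20 with rec.
apply: recN_code; apply: recS_cons; last by auto 20 with rec.
by apply: (recN_let_shift (p := p)) => //; auto 20 with rec.
Qed.
#[local] Hint Extern 1 (recS (fun e => [seq @?p m e | m <- @?s e])) =>
  apply: (@recS_map p s) : rec.

Lemma recB_allS (p : nat -> seq nat -> bool) s :
  recB (fun e => p (nth 0 e 0) (drop 1 e)) -> recS s ->
  recB (fun e => all (fun m => p m e) (s e)).
Proof.
move=> rp rs.
have E e : all (fun i => p (nth 0 (s e) i) e) (iota 0 (size (s e))) =
    all (fun m => p m e) (s e).
  apply/allP/(all_nthP 0) => [h i si|h i]; last by rewrite mem_iota; exact: h.
  by apply: h; rewrite mem_iota.
apply: (recB_ext E); apply: (@recB_all (fun i e => p (nth 0 (s e) i) e));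
  last by auto 20 with rec.
have rs1 : recS (fun e => s (drop 1 e)) by exact: (recN_shiftn 1 rs).
by apply: (recN_let_shift (p := p)) => //; auto 20 with rec.
Qed.
#[local] Hint Extern 2 (recB (fun e => all (fun m => @?p m e) (@?s e))) =>
  apply: (@recB_allS p s) : rec.

(** Here the list does not depend on the environment. The vertices and simplices of the fixed
    complex enter the check through such finite conjunctions, disjunctions and sums, without being
    coded. *)
Lemma recB_allT T (p : T -> seq nat -> bool) l :
  (forall x, recB (p x)) -> recB (fun e => all (fun x => p x e) l).
Proof. by move=> rp; elim: l => [|x l IH] /=; [exact: recN_const | exact: recB_and]. Qed.

Lemma recB_hasT T (p : T -> seq nat -> bool) l :
  (forall x, recB (p x)) -> recB (fun e => has (fun x => p x e) l).
Proof. by move=> rp; elim: l => [|x l IH] /=; [exact: recN_const | exact: recB_or]. Qed.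

Lemma recN_sumT T (f : T -> seq nat -> nat) l :
  (forall x, recN (f x)) -> recN (fun e => \sum_(x <- l) f x e).
Proof.
move=> rf; elim: l => [|x l IH].
  by apply: (recN_ext _ (recN_const 0)) => e; rewrite big_nil.
by apply: (recN_ext _ (recN_add (rf x) IH)) => e; rewrite big_cons.
Qed.

Lemma recN_div f g : recN f -> recN g -> recN (fun e => f e %/ g e).
Proof.
move=> rf rg.
apply: (@recN_minb (fun m e => (g e == 0) || (f e < m.+1 * g e))); first by auto 20 with rec.
- move=> e; case: eqVneq => //= g0; rewrite {1}(divn_eq (f e) (g e)) mulSn addnC ltn_add2r.
  by rewrite ltn_mod lt0n.
- move=> e y; case: eqVneq => [->|g0] yd; first by rewrite divn0 in yd.
  by rewrite /= -leqNgt -leq_divRL ?lt0n.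
Qed.

Lemma recB_odd f : recN f -> recB (fun e => odd (f e)).
Proof.
move=> rf.
have E e : ~~ all (fun r => ~~ (f e == (2 * r).+1)) (iota 0 (f e)) = odd (f e).
  apply/allPn/idP => [[r _]|of_].
    by rewrite negbK => /eqP ->; rewrite /= mul2n odd_double.
  by exists (f e)./2; rewrite ?mem_iota ?negbK; lia.
by apply: (recB_ext E); auto 20 with rec.
Qed.
#[local] Hint Resolve recN_div recB_odd : rec.

(* Course-of-values recursion: [covtab step n] lists the values below [n] in
   decreasing order of the argument, so the value at [k] has index [n - k.+1]. *)
Fixpoint covtab (step : nat -> seq nat -> nat) n :=
  if n is m.+1 then step m (covtab step m) :: covtab step m else [::].

Definition cov step n := step n (covtab step n).

Lemma nth_covtab step n k : k < n -> nth 0 (covtab step n) (n - k.+1) = cov step k.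
Proof.
elim: n => // n IH; rewrite ltnS leq_eqVlt => /predU1P[->|kn].
  by rewrite subnn.
by rewrite subSS -(subnSK kn) /= IH.
Qed.

Lemma recN_cov (step : nat -> seq nat -> seq nat -> nat) n :
  recN (fun e => step (nth 0 e 0) (CodeSeq.decode (nth 0 e 1)) (drop 2 e)) -> recN n ->
  recN (fun e => cov (fun m r => step m r e) (n e)).
Proof.
move=> rst rn.
pose g m r e := CodeSeq.code (step m (CodeSeq.decode r) e :: CodeSeq.decode r).
have E e k : nat_rec (fun=> nat) 0 (fun m r => g m r e) k =
    CodeSeq.code (covtab (fun m r => step m r e) k).
  by elim: k => //= k ->; rewrite /g CodeSeq.codeK.
have rt : recN (fun e => nat_rec (fun=> nat) 0 (fun m r => g m r e) (n e)).
  apply: recN_natrec => //; first exact: recN_const.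
  by apply: recN_code; apply: recS_cons => //; auto 20 with rec.
have H : recN (fun e => head 0 (CodeSeq.decode
    (nat_rec (fun=> nat) 0 (fun m r => g m r e) (n e).+1))).
  apply: recN_head; apply: recS_decode; apply: recN_natrec => //; first exact: recN_const.
    by apply: recN_code; apply: recS_cons => //; auto 20 with rec.
  exact: recN_S.
by apply: recN_ext H => e; rewrite E CodeSeq.codeK.
Qed.

(** * The finite check *)

#[local] Hint Extern 1 (recB _) => match goal with
  | H : recB ?g |- recB (fun e => ?g (@?h e)) => apply: (recN_shift (h := h) H)
  end : rec.
#[local] Hint Extern 1 (recS _) => match goal with
  | H : recS ?g |- recS (fun e => ?g (@?h e)) => apply: (recN_shift (h := h) H)
  end : rec.
#[local] Hint Extern 2 (recB (fun e => all (fun x => @?p x e) ?l)) =>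
  apply: (@recB_allT _ p l) : rec.
#[local] Hint Extern 2 (recB (fun e => has (fun x => @?p x e) ?l)) =>
  apply: (@recB_hasT _ p l) : rec.
#[local] Hint Extern 2 (recN (fun e => \sum_(x <- ?l) @?p x e)) =>
  apply: (@recN_sumT _ p l) : rec.
#[local] Hint Resolve recN_if : rec.

Lemma recS_nseq n x : recN n -> recN x -> recS (fun e => nseq (n e) (x e)).
Proof.
move=> rn rx; have E e : nat_rec (fun=> nat) 0 (fun m r => 2 ^ x e * r.*2.+1) (n e) =
    CodeSeq.code (nseq (n e) (x e)) by elim: (n e) => //= m ->.
apply: (recN_ext E).
by apply: (@recN_natrec _ (fun m r e => 2 ^ x e * r.*2.+1)); auto 20 with rec.
Qed.
#[local] Hint Resolve recS_nseq : rec.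

Section predicate.
Variables (ar : nat -> nat) (V : finType) (K : simplicial_complex V).

(** In the table [r] of earlier verdicts, index [m - k.+1] holds the one on the argument code k. The
    size tests matter: on the empty list [nth] returns 0, which is the tag of a variable. *)
Definition wf_step m r : nat :=
  ((nth 0 (CodeSeq.decode m) 0 == 0) && (size (CodeSeq.decode m) == 2)) ||
  [&& nth 0 (CodeSeq.decode m) 0 == 1,
      size (CodeSeq.decode m) == (ar (nth 0 (CodeSeq.decode m) 1)).+2 &
      all (fun k => nth 0 r (m - k.+1) == 1) (drop 2 (CodeSeq.decode m))].

Definition wf_term m := cov wf_step m == 1.

(** All operations share one flat list, indexed by the code of the symbol followed by its arguments;
    entries past the end read as 0. *)
Definition tab_app T i zs := nth 0 T (CodeSeq.code (i :: zs)).

Definition code_eval_step T a m r :=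
  if nth 0 (CodeSeq.decode m) 0 == 0 then nth 0 a (nth 0 (CodeSeq.decode m) 1)
  else tab_app T (nth 0 (CodeSeq.decode m) 1)
         [seq nth 0 r (m - k.+1) | k <- drop 2 (CodeSeq.decode m)].

Definition code_eval T a m := cov (code_eval_step T a) m.

(** A grid point is coded by the list of its barycentric coordinates multiplied by M. *)
Definition gcoord z (v : V) := nth 0 (CodeSeq.decode z) (enum_rank v).

Definition grid M z :=
  [&& size (CodeSeq.decode z) == #|V|, \sum_v gcoord z v == M &
      has (fun S : {set V} =>
        all (fun v => nat_of_bool (v \in S) == (0 < gcoord z v)) (enum V)) (enum (simplices K))].

Definition grid_tuple M m z :=
  (size (CodeSeq.decode z) == m) && all (grid M) (CodeSeq.decode z).

(** Coordinates of grid points are at most M and list codes are monotone in the entries, so this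
    bounds the codes of all m-tuples of grid points and makes quantifiers over them bounded. *)
Definition tuple_bound M m := (CodeSeq.code (nseq m (CodeSeq.code (nseq #|V| M)))).+1.

(** Stands for a distance of at most k / (c M) in each coordinate, cleared of denominators and free
    of truncated subtraction. *)
Definition close_codes c k z w :=
  all (fun v => (c * gcoord z v <= c * gcoord w v + k) &&
                (c * gcoord w v <= c * gcoord z v + k)) (enum V).

Definition close_tuples k m z w :=
  all (fun l => close_codes 1 k (nth 0 (CodeSeq.decode z) l) (nth 0 (CodeSeq.decode w) l))
    (iota 0 m).

Definition tab_total n M T :=
  all (fun i => all (fun z => grid_tuple M (ar i) z ==>
      grid M (tab_app T i (CodeSeq.decode z)))
    (iota 0 (tuple_bound M (ar i)))) (iota 0 n).

(* The factor [#|V|.+2] leaves room for the error #|V|.+1 * delta that the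
   shrinking by delta in [interpolation] introduces. *)
Definition tab_continuous n M T A :=
  all (fun i => all (fun z => all (fun w =>
      grid_tuple M (ar i) z && grid_tuple M (ar i) w ==>
        all (fun j => close_tuples (2 * nth 0 A j) (ar i) z w ==>
          close_codes #|V|.+2 (nth 0 A j.+1) (tab_app T i (CodeSeq.decode z))
            (tab_app T i (CodeSeq.decode w))) (iota 0 n))
    (iota 0 (tuple_bound M (ar i)))) (iota 0 (tuple_bound M (ar i)))) (iota 0 n).

(* Rounding a point of |K| to the grid moves its coordinates by at most #|V| / M. *)
Definition moduli n x M A :=
  [&& #|V| < nth 0 A 0, all (fun j => nth 0 A j <= nth 0 A j.+1) (iota 0 n) &
      x.+1 * nth 0 A n <= M].

Definition wf_equation k :=
  [&& size (CodeSeq.decode k) == 2, wf_term (nth 0 (CodeSeq.decode k) 0) &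
      wf_term (nth 0 (CodeSeq.decode k) 1)].

(** With factor x+1 and slack M the tolerance is 1/(x+1) whatever M is. *)
Definition tab_satisfies n x M T k :=
  all (fun a => grid_tuple M n a ==>
      close_codes x.+1 M (code_eval T (CodeSeq.decode a) (nth 0 (CodeSeq.decode k) 0))
        (code_eval T (CodeSeq.decode a) (nth 0 (CodeSeq.decode k) 1)))
    (iota 0 (tuple_bound M n)).

(** The last clause runs over the binary digits of n. Requiring [wf_equation] there rejects every n
    that is not the index of a finite set of equations. *)
Definition approx_satisfied n x M T A :=
  [&& moduli n x M A, tab_total n M T, tab_continuous n M T A &
      all (fun k => odd (n %/ 2 ^ k) ==> wf_equation k && tab_satisfies n x M T k)
        (iota 0 n)].

Definition witnessed n x y :=
  approx_satisfied n x (nth 0 (CodeSeq.decode y) 0)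
    (CodeSeq.decode (nth 0 (CodeSeq.decode y) 1))
    (CodeSeq.decode (nth 0 (CodeSeq.decode y) 2)).

Hypothesis ar_recursive : recursive (fun v : 1.-tuple nat => ar (thead v)).

Let recN_ar f : recN f -> recN (fun e => ar (f e)).
Proof. exact: (recN_fun1 (g := ar)). Qed.
#[local] Hint Resolve recN_ar : rec.

Lemma recB_wf_term f : recN f -> recB (fun e => wf_term (f e)).
Proof.
move=> rf; apply: recB_eq; last exact: recN_const.
apply: (@recN_cov (fun m r e => wf_step m r)) => //.
rewrite /wf_step; auto 20 with rec.
Qed.
#[local] Hint Resolve recB_wf_term : rec.

Lemma recN_tab_app T i s : recS T -> recN i -> recS s ->
  recN (fun e => tab_app (T e) (i e) (s e)).
Proof. by move=> rT ri rs; rewrite /tab_app; auto 20 with rec. Qed.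
#[local] Hint Resolve recN_tab_app : rec.

Lemma recN_code_eval T a m : recS T -> recS a -> recN m ->
  recN (fun e => code_eval (T e) (a e) (m e)).
Proof.
move=> rT ra rm; apply: (@recN_cov (fun m r e => code_eval_step (T e) (a e) m r)) => //.
rewrite /code_eval_step; auto 20 with rec.
Qed.
#[local] Hint Resolve recN_code_eval : rec.

Lemma recN_gcoord z v : recN z -> recN (fun e => gcoord (z e) v).
Proof. by move=> rz; rewrite /gcoord; auto with rec. Qed.
#[local] Hint Resolve recN_gcoord : rec.

Lemma recB_grid M z : recN M -> recN z -> recB (fun e => grid (M e) (z e)).
Proof. by move=> rM rz; rewrite /grid; auto 20 with rec. Qed.
#[local] Hint Resolve recB_grid : rec.

Lemma recB_grid_tuple M m z : recN M -> recN m -> recN z ->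
  recB (fun e => grid_tuple (M e) (m e) (z e)).
Proof.
move=> rM rm rz; rewrite /grid_tuple.
apply: recB_and; first by auto with rec.
by apply: (@recB_allS (fun z e => grid (M e) z)); auto 20 with rec.
Qed.
#[local] Hint Resolve recB_grid_tuple : rec.

Lemma recB_close_codes c k z w : recN c -> recN k -> recN z -> recN w ->
  recB (fun e => close_codes (c e) (k e) (z e) (w e)).
Proof. by move=> *; rewrite /close_codes; auto 20 with rec. Qed.
#[local] Hint Resolve recB_close_codes : rec.

Lemma recB_close_tuples k m z w : recN k -> recN m -> recN z -> recN w ->
  recB (fun e => close_tuples (k e) (m e) (z e) (w e)).
Proof. by move=> *; rewrite /close_tuples; auto 20 with rec. Qed.
#[local] Hint Resolve recB_close_tuples : rec.

Lemma recN_tuple_bound M m : recN M -> recN m -> recN (fun e => tuple_bound (M e) (m e)).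
Proof. by move=> *; rewrite /tuple_bound; auto 20 with rec. Qed.
#[local] Hint Resolve recN_tuple_bound : rec.

Lemma recB_tab_total n M T : recN n -> recN M -> recS T ->
  recB (fun e => tab_total (n e) (M e) (T e)).
Proof. by move=> *; rewrite /tab_total; auto 30 with rec. Qed.

Lemma recB_tab_continuous n M T A : recN n -> recN M -> recS T -> recS A ->
  recB (fun e => tab_continuous (n e) (M e) (T e) (A e)).
Proof. by move=> *; rewrite /tab_continuous; auto 40 with rec. Qed.

Lemma recB_moduli n x M A : recN n -> recN x -> recN M -> recS A ->
  recB (fun e => moduli (n e) (x e) (M e) (A e)).
Proof. by move=> *; rewrite /moduli; auto 40 with rec. Qed.

Lemma recB_wf_equation k : recN k -> recB (fun e => wf_equation (k e)).
Proof. by move=> *; rewrite /wf_equation; auto 40 with rec. Qed.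

Lemma recB_tab_satisfies n x M T k : recN n -> recN x -> recN M -> recS T -> recN k ->
  recB (fun e => tab_satisfies (n e) (x e) (M e) (T e) (k e)).
Proof. by move=> *; rewrite /tab_satisfies; auto 40 with rec. Qed.
#[local] Hint Resolve recB_tab_total recB_tab_continuous recB_moduli recB_wf_equation
  recB_tab_satisfies : rec.

Lemma recB_witnessed : recB (fun e => witnessed (nth 0 e 0) (nth 0 e 1) (nth 0 e 2)).
Proof.
have rv i : recN (fun e => nth 0 e i) by exact: recN_nth.
by rewrite /witnessed /approx_satisfied; auto 40 with rec.
Qed.

End predicate.

(** * Codes of terms, equations and finite sets *)

Section codes.
Variable ar : nat -> nat.

Lemma mem_lt_code x s : x \in s -> x < CodeSeq.code s.
Proof. by move=> xs; have /allP/(_ x xs) := CodeSeq.ltn_code s. Qed.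

Lemma term_code_arg i (args : 'I_(ar i) -> term ar) j :
  term_code (args j) < term_code (App args).
Proof. by apply: mem_lt_code; rewrite !inE (map_f (fun j =>
  term_code (args j))) ?orbT// mem_enum. Qed.

Lemma term_code_symbol i (args : 'I_(ar i) -> term ar) : i < term_code (App args).
Proof. by apply: mem_lt_code; rewrite !inE eqxx orbT. Qed.

Lemma term_code_var n : n < term_code (Var ar n).
Proof. by apply: mem_lt_code; rewrite !inE eqxx orbT. Qed.

Lemma decode_var n : CodeSeq.decode (term_code (Var ar n)) = [:: 0; n].
Proof. exact: CodeSeq.codeK. Qed.

Lemma decode_app i (args : 'I_(ar i) -> term ar) :
  CodeSeq.decode (term_code (App args)) =
  [:: 1, i & [seq term_code (args j) | j <- enum 'I_(ar i)]].
Proof. exact: CodeSeq.codeK. Qed.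

Lemma decode_equation (e : equation ar) :
  CodeSeq.decode (equation_code e) = [:: term_code e.1; term_code e.2].
Proof. exact: CodeSeq.codeK. Qed.

Lemma term_code_inj : injective (@term_code ar).
Proof.
elim=> [n|i args IH] [m|i' args'] E; have := can_inj CodeSeq.codeK E => //.
  by case=> ->.
clear E; case=> ii'; subst i' => /eq_in_map eqa.
by congr App; apply/funext => j; apply: IH; apply: eqa; rewrite mem_enum.
Qed.

Lemma equation_code_inj : injective (@equation_code ar).
Proof. by case=> a b [c d] E; have [/term_code_inj -> /term_code_inj ->] := can_inj
  CodeSeq.codeK E. Qed.

Lemma cov_wf_stepE m : cov (wf_step ar) m =
  ((nth 0 (CodeSeq.decode m) 0 == 0) && (size (CodeSeq.decode m) == 2)) ||
  [&& nth 0 (CodeSeq.decode m) 0 == 1,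
      size (CodeSeq.decode m) == (ar (nth 0 (CodeSeq.decode m) 1)).+2 &
      all (wf_term ar) (drop 2 (CodeSeq.decode m))].
Proof.
rewrite {1}/cov {1}/wf_step; congr (nat_of_bool (_ || [&& _, _ & _])).
apply: eq_in_all => k /mem_drop kd; rewrite nth_covtab//.
by rewrite -[ltnRHS]CodeSeq.decodeK; exact: mem_lt_code.
Qed.

Lemma wf_termP m : reflect (exists s : term ar, term_code s = m) (wf_term ar m).
Proof.
rewrite /wf_term cov_wf_stepE eqb1; apply: (iffP idP) => [|[s <-]]; last first.
  elim: s => [n|i args IH]; rewrite ?decode_var// decode_app /=.
  rewrite drop0 size_map size_enum_ord eqxx /=.
  apply/allP => _ /mapP[j _ ->]; rewrite /wf_term cov_wf_stepE eqb1; exact: IH.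
elim/ltn_ind: m => m IH /orP[|].
  rewrite -{3}(CodeSeq.decodeK m).
  case: (CodeSeq.decode m) => [|x [|n [|y l]]]; rewrite /= ?andbF// andbT.
  by move=> /eqP ->; exists (Var ar n).
case E : (CodeSeq.decode m) => [|x [|i l]]; rewrite /= ?andbF//.
move=> /and3P[/eqP x1 /eqP[sl] /allP wl].
rewrite drop0 in wl.
have H (j : 'I_(ar i)) : exists s : term ar, term_code s = nth 0 l j.
  have jl : nth 0 l j \in l by rewrite mem_nth// sl.
  apply: IH; last by have := wl _ jl; rewrite /wf_term cov_wf_stepE eqb1.
  by rewrite -(CodeSeq.decodeK m) E; apply: mem_lt_code; rewrite !inE jl !orbT.
have [args argsE] := choice H; exists (App args).
rewrite -(CodeSeq.decodeK m) E x1 /=; congr (CodeSeq.code [:: 1, i & _]).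
apply: (@eq_from_nth _ 0) => [|k]; rewrite size_map size_enum_ord ?sl// => kl.
by rewrite (nth_map (Ordinal kl)) ?size_enum_ord// argsE nth_enum_ord.
Qed.

Definition tab_algebra T : algebra ar nat :=
  fun i args => tab_app T i [seq args j | j <- enum 'I_(ar i)].

Lemma code_eval_term T a (s : term ar) :
  code_eval T a (term_code s) = term_op (tab_algebra T) s (nth 0 a).
Proof.
elim: s => [n|i args IH]; rewrite /code_eval /cov {1}/code_eval_step.
  by rewrite decode_var.
rewrite decode_app /= drop0 -map_comp; congr tab_app.
apply: eq_map => j; rewrite -IH.
exact: (nth_covtab _ (term_code_arg args j)).
Qed.

Lemma wf_equationP k :
  reflect (exists e : equation ar, equation_code e = k) (wf_equation ar k).
Proof.
apply: (iffP idP) => [|[[s t] <-]]; last first.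
  rewrite /wf_equation decode_equation /=.
  by apply/andP; split; apply/wf_termP; [exists s | exists t].
rewrite /wf_equation -{4}(CodeSeq.decodeK k).
case: (CodeSeq.decode k) => [|a [|b []]] //= /andP[/wf_termP[s <-] /wf_termP[t <-]].
by exists (s, t).
Qed.

Lemma equation_code_l (e : equation ar) : term_code e.1 < equation_code e.
Proof. by apply: mem_lt_code; rewrite !inE eqxx. Qed.

Lemma equation_code_r (e : equation ar) : term_code e.2 < equation_code e.
Proof. by apply: mem_lt_code; rewrite !inE eqxx orbT. Qed.

(** * Binary digits and the canonical index of a finite set *)

Definition bit n k := odd (n %/ 2 ^ k).

Lemma bit_lt n k : bit n k -> k < n.
Proof.
rewrite /bit; case: (ltnP n (2 ^ k)) => [/divn_small -> //|kn _].
by apply: leq_trans kn; exact: ltn_expl.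
Qed.

Lemma bitS n k : bit n k.+1 = bit n./2 k.
Proof. by rewrite /bit expnS divnMA divn2. Qed.

Lemma bit_inj n m : bit n =1 bit m -> n = m.
Proof.
elim/ltn_ind: n m => n IH m nm.
have := nm 0; rewrite /bit expn0 !divn1 => o.
case: (posnP n) => [n0|n0].
  have b0 k : bit n k = false by rewrite n0 /bit div0n.
  case: (posnP m) => [->//|m0].
  (* A positive m has leading digit 1 at position [trunc_log 2 m], while all digits of n = 0
     vanish. *)
  have := nm (trunc_log 2 m); rewrite b0 /bit.
  have /andP[h1 h2] := trunc_log_bounds (isT : 1 < 2) m0.
  suff -> : m %/ 2 ^ trunc_log 2 m = 1 by [].
  apply/eqP; rewrite eqn_leq leq_divRL ?expn_gt0// mul1n h1 andbT.
  by rewrite -ltnS ltn_divLR ?expn_gt0// -expnS.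
rewrite -[n]odd_double_half -[m]odd_double_half o (IH n./2 _ m./2)//; first by lia.
by move=> k; rewrite -!bitS.
Qed.

Lemma bit_sum (b : nat -> bool) N k :
  bit (\sum_(i < N) b i * 2 ^ i) k = (k < N) && b k.
Proof.
elim: N b k => [|N IH] b k; first by rewrite big_ord0 /bit div0n.
have E : \sum_(i < N.+1) b i * 2 ^ i = b 0 + (\sum_(i < N) b i.+1 * 2 ^ i).*2.
  rewrite big_ord_recl /= expn0 muln1 -mul2n big_distrr /=; congr addn.
  by apply: eq_bigr => i _; rewrite /bump /= expnS mulnCA.
rewrite E; case: k => [|k].
  by rewrite /bit expn0 divn1 oddD odd_double addbF; case: (b 0).
by rewrite bitS half_bit_double (IH (b \o succn)) ltnS.
Qed.

Lemma bit_sum_seq s k : uniq s -> bit (\sum_(i <- s) 2 ^ i) k = (k \in s).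
Proof.
move=> us; pose N := (\max_(i <- s) i).+1.
have lt i : i \in s -> i < N by move=> si; rewrite ltnS; exact: (@leq_bigmax_seq _ _ xpredT id).
have -> : \sum_(i <- s) 2 ^ i = \sum_(i < N) (nat_of_ord i \in s) * 2 ^ i.
  rewrite -(big_mkord xpredT (fun i => (i \in s) * 2 ^ i)).
  rewrite [RHS](eq_bigr (fun i => if i \in s then 2 ^ i else 0)); last first.
    by move=> i _; case: (i \in s); rewrite ?mul1n.
  rewrite -[RHS]big_mkcond -[RHS]big_filter; apply: perm_big; apply: uniq_perm => //.
    by rewrite filter_uniq ?iota_uniq.
  by move=> i; rewrite mem_filter mem_index_iota /=; case: (boolP (i \in s)) => // /lt ->.
by rewrite bit_sum; apply: andb_idl => /lt.
Qed.

Local Open Scope classical_set_scope.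

Lemma bit_finset_code (Sigma : set (equation ar)) k : finite_set Sigma ->
  bit (finset_code Sigma) k <-> exists2 e, Sigma e & equation_code e = k.
Proof.
move=> fS; rewrite /finset_code fsbig_finite//=.
have -> : (\sum_(i <- finmap.enum_fset (fset_set Sigma)) (2 ^ equation_code i)%N)%R =
    \sum_(i <- [seq equation_code e | e <- finmap.enum_fset (fset_set Sigma)]) 2 ^ i by rewrite
      big_map.
rewrite bit_sum_seq; last by rewrite map_inj_uniq ?finmap.fset_uniq//; exact: equation_code_inj.
split=> [/mapP[e]|[e Se <-]]; last by rewrite map_f// in_fset_set// inE.
by rewrite in_fset_set// inE => Se ->; exists e.
Qed.

Definition coded_set n : set (equation ar) := [set e | bit n (equation_code e)].

Lemma finite_coded_set n : finite_set (coded_set n).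
Proof.
have : finite_set (@equation_code ar @^-1` [set k | k < n]).
  apply: finite_preimage; last exact: finite_II.
  by move=> ? ? _ _; exact: equation_code_inj.
by apply: sub_finite_set => e /bit_lt.
Qed.

Lemma coded_setK (Sigma : set (equation ar)) : finite_set Sigma ->
  coded_set (finset_code Sigma) = Sigma.
Proof.
move=> fS; apply/seteqP; split=> e; last by move=> Se; apply/bit_finset_code => //; exists e.
by move/(bit_finset_code _ fS) => [e' Se' /equation_code_inj <-].
Qed.

Lemma finset_codeK n : (forall k, bit n k -> wf_equation ar k) ->
  finset_code (coded_set n) = n.
Proof.
move=> h; apply: bit_inj => k; apply/idP/idP.
  by move/(bit_finset_code _ (finite_coded_set n)) => [e + <-].
move=> nk; apply/bit_finset_code; first exact: finite_coded_set.
by have /wf_equationP[e ek] := h _ nk; exists e => //; rewrite /coded_set /= ek.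
Qed.

(** A finite set is recovered from its index by [coded_set], so the quantifier over sets turns into
    a condition on n alone. *)
Lemma image_finset_code (P : set (equation ar) -> Prop) n :
  [set finset_code Sigma | Sigma in [set Sigma | finite_set Sigma /\ P Sigma]] n <->
  (forall k, bit n k -> wf_equation ar k) /\ P (coded_set n).
Proof.
split=> [[Sigma [fS PS] <-]|[h Pn]].
  rewrite coded_setK//; split=> // k /(bit_finset_code _ fS)[e _ ek].
  by apply/wf_equationP; exists e.
by exists (coded_set n); rewrite ?finset_codeK//; split=> //; exact: finite_coded_set.
Qed.

Lemma leq_code_nseq m M s : size s = m -> all (fun x => x <= M) s ->
  CodeSeq.code s <= CodeSeq.code (nseq m M).
Proof.
elim: m s => [|m IH] [|x s] //= [sm] /andP[xM aM].
by apply: leq_mul; rewrite ?leq_exp2l// ltnS leq_double; exact: IH.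
Qed.

End codes.

Section grid_codes.
Variables (V : finType) (K : simplicial_complex V).

Lemma nth_gcoord z i (iV : i < #|V|) : nth 0 (CodeSeq.decode z) i = gcoord z (enum_val (Ordinal
  iV) : V).
Proof. by rewrite /gcoord enum_valK. Qed.

Lemma grid_leq M z : grid K M z -> z <= CodeSeq.code (nseq #|V| M).
Proof.
case/and3P => /eqP sz /eqP sM _; rewrite -{1}(CodeSeq.decodeK z).
apply: leq_code_nseq => //; apply/(all_nthP 0) => i; rewrite sz => iV.
by rewrite nth_gcoord -sM (bigD1 (enum_val (Ordinal iV)))//= leq_addr.
Qed.

Lemma grid_tuple_lt M m z : grid_tuple K M m z -> z < tuple_bound V M m.
Proof.
case/andP=> /eqP sz /allP gz; rewrite ltnS -{1}(CodeSeq.decodeK z).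
by apply: leq_code_nseq => //; apply/allP => x /gz /grid_leq.
Qed.

End grid_codes.

(** * Compactness of the realization *)

Import Order.TTheory GRing.Theory Num.Theory.
Import numFieldNormedType.Exports.
Local Open Scope classical_set_scope.
Local Open Scope ring_scope.

Lemma nbhs_mdistE (R : realType) (T : metricType R) (x : T) (A : set T) :
  nbhs x A <-> exists2 e : R, 0 < e & forall y, mdist x y < e -> A y.
Proof.
split=> [/nbhs_ballP[e e0]|[e e0 eA]]; last apply/nbhs_ballP.
  by rewrite ballEmdist => eA; exists e => // y; exact: eA.
by exists e => //; rewrite ballEmdist.
Qed.

(** The product topology is coarser than the uniform one: the filter of uniform balls converges to x
    because it does so in each coordinate. *)
Lemma nbhs_ptws_ball (R : realType) (I : eqType) (T : metricType R)
    (x : {ptws I -> T}) (A : set {ptws I -> T}) : nbhs x A ->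
  exists2 e : R, 0 < e & forall y, (forall i, mdist (x i) (y i) < e) -> A y.
Proof.
pose B (e : R) : set {ptws I -> T} := [set y | forall i, mdist (x i) (y i) < e].
have FB : Filter (filter_from [set e : R | 0 < e] B).
  apply: filter_from_filter; first by exists 1 => /=.
  move=> e f /= e0 f0; exists (Num.min e f); first by rewrite /= lt_min e0.
  by move=> y yB; split => i; have := yB i; rewrite lt_min => /andP[].
suff GA : filter_from [set e : R | 0 < e] B --> x.
  by move=> /GA[e e0 eA]; exists e => // y; exact: eA.
apply/cvg_sup => i A'. rewrite nbhsE => -[U [[W oW <-] Wx] UA].
have /nbhs_mdistE [e e0 eW] : nbhs (x i) W by apply: open_nbhs_nbhs; split.
by exists e => // y yB; apply: UA; apply: eW; exact: yB.
Qed.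

Section realization_topology.
Context (R : realType) (V : finType) (K : simplicial_complex V).
Local Notation T := (realization R K).
Implicit Types (p q : T) (v : V).

Lemma coords_ge0 p v : 0 <= p v.
Proof. by case: p => b /= /and3P[/forallP/(_ v)/andP[]]. Qed.

Lemma coords_sum p : \sum_v p v = 1.
Proof. by case: p => b /= /and3P[_ /eqP]. Qed.

Lemma coords_supp p : [set v | 0 < p v]%SET \in simplices K.
Proof. by case: p => b /= /and3P[]. Qed.

(** Closeness in the maximum norm is what integer tables can test; the next two lemmas compare it
    with the Euclidean distance. *)
Definition near_within (r : R) p q := forall v, `|p v - q v| <= r.

Lemma coord_le_mdist p q : near_within (mdist p q) p q.
Proof.
move=> v; rewrite -sqrtr_sqr; apply: ler_wsqrtr.
by rewrite (bigD1 v)//= lerDl sumr_ge0// => w _; rewrite sqr_ge0.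
Qed.

Lemma mdist_near_within r p q : near_within r p q -> 0 <= r -> mdist p q <= #|V|%:R * r.
Proof.
move=> pq r0; rewrite -(ger0_norm (mulr_ge0 (ler0n _ _) r0)) -sqrtr_sqr; apply: ler_wsqrtr.
case: (posnP #|V|) => [V0|V0].
  rewrite big1 ?sqr_ge0// => v _; have := card0_eq V0 v; by rewrite inE.
apply: (@le_trans _ _ (\sum_(v : V) r ^+ 2)).
  by apply: ler_sum => v _; rewrite -real_normK ?num_real// lerXn2r ?nnegrE.
rewrite sumr_const -[_ *+ _]mulr_natl exprMn ler_wpM2r ?sqr_ge0//.
by rewrite expr2 ler_peMl ?ler1n// ler0n.
Qed.

Lemma continuous_coord v : continuous (fun p => p v : R).
Proof.
move=> p; apply/(@cvgrPdist_lt _ _ _ (nbhs p) (nbhs_filter p)) => e e0; apply/nbhs_mdistE;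
  exists e => // q pq.
exact: le_lt_trans (coord_le_mdist p q v) pq.
Qed.

Lemma cvg_coords (X : Type) (F : set_system X) (FF : Filter F) (f : X -> T) p :
  (forall v, f x v @[x --> F] --> (p v : R)) -> f @ F --> p.
Proof.
move=> fp A /nbhs_mdistE[e e0 eA].
pose r : R := e / (2 * #|V|.+1%:R).
have r0 : 0 < r by rewrite divr_gt0// mulr_gt0.
have H : \forall x \near F, forall v, `|p v - f x v| <= r.
  apply: filter_forall => v; near=> x; apply: ltW; near: x.
  by have /cvgrPdist_lt := fp v; apply.
apply: filterS H => x px; apply: eA => /=.
apply: le_lt_trans (mdist_near_within px (ltW r0)) _.
rewrite /r mulrA ltr_pdivrMr ?mulr_gt0// mulrC ltr_pM2l// -natrM ltr_nat.
lia.
Unshelve. all: by end_near. Qed.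

(* The condition that the support is a simplex is closed: for every non-simplex
   the product of the coordinates over it vanishes. *)
Lemma compact_coords : compact [set b : {ptws V -> R} | in_realization K [ffun v => b v]].
Proof.
pose Q : set {ptws V -> R} := [set b | forall v, `[0, 1]%classic (b v)].
have cQ : compact Q.
  apply: (@tychonoff V (fun=> R : topologicalType) (fun=> `[0, 1]%classic)) => _.
  exact: segment_compact.
have cproj v : continuous (fun b : {ptws V -> R} => b v : R).
  exact: (@proj_continuous V (fun=> R : topologicalType) v).
pose Z (f : {ptws V -> R} -> R) (c : R) : set {ptws V -> R} := [set b | f b = c].
have clZ f c : continuous f -> closed (Z f c).
  move=> cf; apply: (@preimage_closed _ _ f [set c]) => //; exact: closed_eq.
set C := [set b | _].
have -> : C = Q `&` (Z (fun b => \sum_v b v) 1 `&`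
    \bigcap_(S in [set S : {set V} | (S != finset.set0) && (S \notin simplices K)])
      Z (fun b => \prod_(v in S) b v) 0).
  apply/seteqP; split=> b.
    rewrite /C /= => /and3P[/forallP b01 /eqP b1 bK]; split; last split.
    - by move=> v; have := b01 v; rewrite ffunE /= in_itv.
    - by rewrite /Z /= -[RHS]b1; apply: eq_bigr => v _; rewrite ffunE.
    - move=> S /= /andP[S0 SK]; apply/eqP; apply: contraNT SK => pS.
      apply: (simplices_sub bK) => //; apply/fintype.subsetP => v vS.
      rewrite inE ffunE lt_neqAle; have := b01 v; rewrite ffunE => /andP[-> _].
      rewrite andbT eq_sym; apply: contraNneq pS => bv.
      by rewrite (bigD1 v)//= bv mul0r.
  move=> [bQ [b1 bS]]; rewrite /C /=; apply/and3P; split.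
  - by apply/forallP => v; have := bQ v; rewrite ffunE /= in_itv.
  - by apply/eqP; rewrite -[RHS]b1; apply: eq_bigr => v _; rewrite ffunE.
  - apply/negPn/negP => SK; set S := [set v | _]%SET in SK.
    have bS0 v : v \in S -> 0 < b v by rewrite inE ffunE.
    have S0 : S != finset.set0.
      apply: contra_eq_neq b1 => S0; rewrite big1 ?(eq_sym 0) ?oner_neq0// => v _.
      apply/eqP; rewrite eq_le; have := bQ v; rewrite /= in_itv /= => /andP[-> _].
      rewrite andbT leNgt; have : v \notin S by rewrite S0 finset.in_set0.
      by rewrite inE ffunE.
    have /= := bS S; rewrite S0 SK => /(_ isT) p0.
    have : 0 < \prod_(v in S) b v by apply: prodr_gt0 => v /bS0.
    by rewrite p0 ltxx.
apply: compact_closedI => //.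
apply: closedI.
  apply: clZ; apply: continuous_big => // [[x y]]; exact: add_continuous.
apply: closed_bigI => S _; apply: clZ.
apply: continuous_big => // [[x y]]; exact: mul_continuous.
Qed.

Lemma compact_realization : compact [set: T].
Proof.
have [->|/set0P[p0 _]] := eqVneq [set: T] set0; first exact: compact0.
(* |K| is the image of the compact set of coordinate vectors; the default [p0] is only taken outside
   that set. *)
pose g (b : {ptws V -> R}) : T := insubd p0 [ffun v => b v].
set C := [set b : {ptws V -> R} | in_realization K [ffun v => b v]].
have gE b v : C b -> g b v = b v by move=> Cb; rewrite /g insubdK// ffunE.
have -> : [set: T] = g @` C.
  apply/seteqP; split=> // p _; exists (fun v => p v).
    by rewrite /C /=; case: p => c cK; rewrite (_ : finfun _ = c)//; apply/ffunP => v;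
      rewrite ffunE.
  apply/val_inj; rewrite /= /g insubdK; last first.
    by case: p => c cK; rewrite (_ : finfun _ = c)//; apply/ffunP => v; rewrite ffunE.
  by apply/ffunP => v; rewrite ffunE.
apply: continuous_compact compact_coords.
apply/subspace_continuousP => b Cb; apply: cvg_coords => v.
rewrite gE//.
have : (b' : {ptws V -> R}) v @[b' --> within C (nbhs b)] --> (b v : R).
  apply: (cvg_trans _ (@proj_continuous V (fun=> R : topologicalType) v b)).
  apply: cvg_app; exact: cvg_within.
apply: cvg_trans; apply: near_eq_cvg.
have : within C (nbhs b) C by exact: withinT.
by apply: filterS => b' Cb'; rewrite gE.
Qed.

End realization_topology.

(** * Interpolation *)

Lemma continuous_tent (R : realType) (h a : R) :
  continuous (fun t : R => Num.max 0 (h - `|t - a|) : R).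
Proof.
move=> t; apply: (@continuous_max R R (fun=> 0) (fun t => h - `|t - a|)).
  exact: cst_continuous.
apply: (@cvgB R R^o); first exact: cvg_cst.
by apply: cvg_norm; apply: (@cvgB R R^o); [exact: cvg_id|exact: cvg_cst].
Qed.

Section operations.
Context (R : realType) (V : finType) (K : simplicial_complex V).
Local Notation T := (realization R K).
Implicit Types (p q : T) (v : V).

(** The Heine-Cantor argument: the property holds near each tuple for all small d > 0, and
    compactness of the power of |K| makes one d serve all tuples. *)
Lemma uniform_continuity m (F : ('I_m -> T) -> T) (e : R) :
  continuous (F : {ptws 'I_m -> T} -> T) -> 0 < e ->
  exists2 d : R, 0 < d & forall y z, (forall l, near_within d (y l) (z l)) ->
    near_within e (F y) (F z).
Proof.
move=> cF e0.
have cT : compact [set y : {ptws 'I_m -> T} | forall l, [set: T] (y l)].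
  by apply: (@tychonoff 'I_m (fun=> T : topologicalType) (fun=> setT)) => _;
    exact: compact_realization.
have /compact_near_coveringP/(_ R 0^'+ (fun d y => forall z,
    (forall l, near_within d (y l) (z l)) -> near_within e (F y) (F z)) _) := cT.
case=> [x _|d /= d0 H].
  have e20 : 0 < e / 2 by rewrite divr_gt0.
  have : nbhs x [set y | mdist (F x) (F y) < e / 2].
    by apply: (cF x [set w | mdist (F x) w < e / 2]); apply/nbhs_mdistE; exists (e / 2).
  move=> /nbhs_ptws_ball[n n0 nF].
  (* Below this bound, coordinatewise closeness d gives distance less than n / 2, as
     [mdist_near_within] costs a factor |V|. *)
  have c0 : 0 < n / 2 / #|V|.+1%:R by rewrite !divr_gt0.
  exists ([set y | forall l, mdist (x l) (y l) < n / 2],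
          [set d | 0 < d < n / 2 / #|V|.+1%:R]) => /=.
    split.
      have : \forall y \near (x : {ptws 'I_m -> T}), forall l, mdist (x l) (y l) < n / 2.
        apply: (@filter_forall _ _ (fun l =>
          [set y : {ptws 'I_m -> T} | mdist (x l) (y l) < n / 2])
          _ (nbhs_filter (x : {ptws 'I_m -> T}))) => l.
        apply: (@proj_continuous 'I_m (fun=> T : topologicalType) l x [set w | mdist (x l) w <
          n / 2]).
        by apply/nbhs_mdistE; exists (n / 2); rewrite ?divr_gt0.
      by [].
    near=> d; apply/andP; split; near: d; [exact: nbhs_right_gt|exact: nbhs_right_lt].
  case=> y d /= [xy /andP[d0 dn]] z yz.
  have xz l : mdist (x l) (z l) < n.
    apply: le_lt_trans (metric_triangle _ (y l) _) _; rewrite [n]splitr ltrD//.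
    apply: le_lt_trans (mdist_near_within (yz l) (ltW d0)) _.
    move: dn; rewrite ltr_pdivlMr// mulrC; apply: le_lt_trans.
    by rewrite ler_wpM2r ?ler_nat// ltW.
  have n2 : n / 2 < n by rewrite ltr_pdivrMr// ltr_pMr// ltr1n.
  have Fy : mdist (F x) (F y) < e / 2 by apply: nF => l; apply: lt_trans (xy l) n2.
  have Fz : mdist (F x) (F z) < e / 2 by apply: nF.
  move=> v; apply: le_trans (coord_le_mdist (F y) (F z) v) _.
  apply: le_trans (metric_triangle _ (F x) _) _.
  by rewrite [e]splitr lerD// ltW// metric_sym.
exists (d / 2); first by rewrite divr_gt0.
move=> y z yz; apply: (H (d / 2)) => //=.
- by rewrite sub0r normrN gtr0_norm ?divr_gt0// ltr_pdivrMr// ltr_pMr// ltr1n.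
- by rewrite divr_gt0.
Unshelve. all: by end_near. Qed.

Lemma in_realization_normalize (N : V -> R) : (forall v, 0 <= N v) ->
  [set v | 0 < N v]%SET \in simplices K ->
  in_realization K [ffun v => N v / \sum_w N w].
Proof.
move=> N0 NK.
have S0 : 0 < \sum_w N w.
  have [v] : exists v, v \in [set v | 0 < N v]%SET.
    apply/finset.set0Pn; apply: contraNneq (simplices_neq0 K) => <-; exact: NK.
  rewrite inE => Nv; rewrite (bigD1 v)//=.
  by rewrite ltr_pwDl// sumr_ge0.
apply/and3P; split.
- apply/forallP => v; rewrite ffunE divr_ge0 ?(ltW S0)//= ler_pdivrMr// mul1r.
  by rewrite (bigD1 v)//= lerDl sumr_ge0.
- under eq_bigr do rewrite ffunE.
  by rewrite -mulr_suml divff// gt_eqF.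
- congr (_ \in simplices K): NK; apply/setP => v.
  by rewrite !inE ffunE pmulr_lgt0// invr_gt0.
Qed.

(** The error (|V|+1) d has two sources: lowering the values by d shifts the weighted mean by at
    most d, and renormalizing adds at most |V| d, since the lowered coordinates of a point sum to
    between 1 - |V| d and 1. *)
Lemma interpolation (p0 : T) m (I : finType) (c : I -> 'I_m -> T) (u : I -> T) (h d : R) :
  0 < h -> 0 <= d -> #|V|%:R * d < 1 ->
  (forall y : 'I_m -> T, exists i, forall l v, `|y l v - c i l v| < h) ->
  (forall i j, (forall l, near_within (2 * h) (c i l) (c j l)) ->
     near_within d (u i) (u j)) ->
  exists2 F : ('I_m -> T) -> T, continuous (F : {ptws 'I_m -> T} -> T) &
    forall y q r, (forall i, (forall l, near_within h (y l) (c i l)) ->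
        near_within r (u i) q) ->
      near_within (r + #|V|.+1%:R * d) (F y) q.
Proof.
move=> h0 d0 Vd net ucont.
pose psi i (y : {ptws 'I_m -> T}) : R :=
  \prod_l \prod_v Num.max 0 (h - `|y l v - c i l v|).
pose N (y : {ptws 'I_m -> T}) v : R := \sum_i psi i y * Num.max 0 (u i v - d).
pose F (y : {ptws 'I_m -> T}) : T := insubd p0 [ffun v => N y v / \sum_w N y w].
have max0 (x : R) : 0 <= Num.max 0 x by rewrite le_max lexx.
have psi0 i y : 0 <= psi i y by rewrite prodr_ge0// => l _; rewrite prodr_ge0.
have N0 y v : 0 <= N y v by rewrite sumr_ge0// => i _; rewrite mulr_ge0.
have psiP i y : psi i y != 0 -> forall l, near_within h (y l) (c i l).
  move=> /prodf_neq0 yi l v; have /prodf_neq0/(_ v isT) := yi l isT.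
  by case: (lerP (h - _) 0) => [|/ltW]; rewrite ?subr_ge0 ?eqxx.
have psiE y : exists i, 0 < psi i y.
  have [i yi] := net y; exists i; rewrite prodr_gt0// => l _; rewrite prodr_gt0// => v _.
  by rewrite lt_max subr_gt0 yi orbT.
(* A vertex with positive [N] satisfies [d < u j v] for some active j. Both i and j are within h of
   y, hence within 2 h of each other, and [ucont] keeps [u i v] positive. *)
have supp y i : 0 < psi i y -> ([set v | 0 < N y v] \subset [set v | 0 < u i v])%SET.
  move=> yi; apply/fintype.subsetP => v; rewrite !inE.
  case: (boolP [exists j, (psi j y != 0) && (d < u j v)]) => [/existsP[j]|].
    move=> /andP[yj uj] _; have ij : forall l, near_within (2 * h) (c j l) (c i l).
      move=> l w; have := psiP _ _ yj l w; have := psiP i y (lt0r_neq0 yi) l w.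
      by rewrite !ler_norml => /andP[? ?] /andP[? ?]; apply/andP; split; lra.
    by have := ucont _ _ ij v; rewrite ler_norml => /andP[? ?]; lra.
  rewrite negb_exists => /forallP H; rewrite /N big1 ?ltxx// => j _.
  by have := H j; rewrite negb_and negbK -leNgt => /orP[/eqP ->|uj];
    rewrite ?mul0r// (max_idPl _) ?mulr0// subr_le0.
have sum_max i : 1 - #|V|%:R * d <= \sum_v Num.max 0 (u i v - d) <= 1.
  apply/andP; split; last first.
    rewrite -(coords_sum (u i)); apply: ler_sum => v _.
    by rewrite ge_max coords_ge0 gerBl.
  rewrite -[X in X - _](coords_sum (u i)) mulr_natl -sumr_const -sumrB; apply: ler_sum => v _.
  by rewrite le_max lexx orbT.
pose Psi y := \sum_i psi i y.
have Psi0 y : 0 < Psi y.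
  have [i yi] := psiE y; rewrite /Psi (bigD1 i)//= ltr_pwDl// sumr_ge0//.
have sumN y : \sum_v N y v = \sum_i psi i y * \sum_v Num.max 0 (u i v - d).
  by rewrite exchange_big; apply: eq_bigr => i _; rewrite mulr_sumr.
have sumN_ge y : Psi y * (1 - #|V|%:R * d) <= \sum_v N y v.
  rewrite sumN mulr_suml; apply: ler_sum => i _; apply: ler_wpM2l => //.
  by have /andP[] := sum_max i.
have sumN_le y : \sum_v N y v <= Psi y.
  rewrite sumN -[Psi y]mulr1 mulr_suml; apply: ler_sum => i _; apply: ler_wpM2l => //.
  by have /andP[] := sum_max i.
have sumN0 y : 0 < \sum_v N y v.
  by apply: lt_le_trans (sumN_ge y); rewrite mulr_gt0// subr_gt0.
have NK y : [set v | 0 < N y v]%SET \in simplices K.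
  have [i yi] := psiE y; apply: (simplices_sub (coords_supp (u i))); first exact: supp.
  apply/negP => /eqP S0; have := sumN0 y; rewrite big1 ?ltxx// => v _.
  apply/eqP; rewrite eq_le N0 andbT leNgt; apply/negP => Nv.
  by have := finset.in_set0 v; rewrite -S0 inE Nv.
have FE y v : F y v = N y v / \sum_w N y w.
  by rewrite /F insubdK ?ffunE//; exact: in_realization_normalize.
exists F.
  have cpsi i : continuous (psi i).
    apply: continuous_big => [[? ?]|l _]; first exact: mul_continuous.
    apply: continuous_big => [[? ?]|v _]; first exact: mul_continuous.
    have cl : continuous (fun y : {ptws 'I_m -> T} => y l v : R).
      move=> y; apply: (cvg_comp (fun y : {ptws 'I_m -> T} => y l) (fun p : T => p v : R)).
        exact: (@proj_continuous 'I_m (fun=> T : topologicalType) l y).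
      exact: continuous_coord.
    move=> y; apply: (@cvg_comp _ _ _ (fun y : {ptws 'I_m -> T} => y l v : R)
      (fun t : R => Num.max 0 (h - `|t - c i l v|) : R) _ _ _ (cl y)).

    exact: continuous_tent.
  have cN v : continuous (N ^~ v).
    apply: continuous_big => [[? ?]|i _]; first exact: add_continuous.
    move=> y; apply: (@continuousM R _ (psi i) (fun=> Num.max 0 (u i v - d))).
      exact: cpsi.
    exact: cst_continuous.
  have cS : continuous (fun y => \sum_w N y w).
    by apply: continuous_big => [[? ?]|w _]; [exact: add_continuous|exact: cN].
  move=> y; apply: (@cvg_coords _ _ _ _ (nbhs y) (nbhs_filter y)) => v.
  rewrite FE; under eq_cvg do rewrite FE.
  apply: (@continuousM R _ (N ^~ v) (fun y => (\sum_w N y w)^-1)); first exact: cN.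
  by apply: (@continuousV R _ (fun y => \sum_w N y w)); [rewrite gt_eqF|exact: cS].
move=> y q r yq v; rewrite FE.
have Nle : N y v <= Psi y * (q v + r).
  rewrite mulr_suml; apply: ler_sum => i _.
  have [->|yi] := eqVneq (psi i y) 0; first by rewrite !mul0r.
  apply: ler_wpM2l => //; have := yq i (psiP i y yi) v; have := coords_ge0 (u i) v.
  by rewrite ler_norml ge_max => ? /andP[? ?]; apply/andP; split; lra.
have Nge : Psi y * (q v - r - d) <= N y v.
  rewrite mulr_suml; apply: ler_sum => i _.
  have [->|yi] := eqVneq (psi i y) 0; first by rewrite !mul0r.
  apply: ler_wpM2l => //; have := yq i (psiP i y yi) v.
  by rewrite ler_norml le_max => /andP[? ?]; apply/orP; right; lra.
have NS : N y v <= \sum_w N y w by rewrite (bigD1 v)//= lerDl sumr_ge0.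
have /= := sumN_ge y; have := sumN_le y; have := sumN0 y; have := Psi0 y.
move: (\sum_w N y w) (N y v) (Psi y) (N0 y v) NS Nle Nge => S n P n0 nS nle nge P0 S0 SP PS.
have a1 : n / S <= 1 by rewrite ler_pdivrMr// mul1r.
have aP : n / P <= n / S by rewrite ler_wpM2l// lef_pV2.
have bu : n / P <= q v + r by rewrite ler_pdivrMr// mulrC.
have bl : q v - r - d <= n / P by rewrite ler_pdivlMr// mulrC.
have t1 : 1 - #|V|%:R * d <= S / P by rewrite ler_pdivlMr// mulrC.
have t2 : S / P <= 1 by rewrite ler_pdivrMr// mul1r.
have abt : n / P = (n / S) * (S / P) by rewrite mulrA divfK// gt_eqF.
have a0 : 0 <= n / S by rewrite divr_ge0// ltW.
(* [n / S] is the coordinate of F y and [n / P] the weighted mean before renormalization; their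
   ratio S / P lies in [1 - |V| d, 1]. *)
have ab : n / S - n / P <= #|V|%:R * d.
  rewrite abt -{1}[n / S]mulr1 -mulrBr.
  by apply: le_trans (ler_piMl _ a1) _; lra.
have Vd0 : 0 <= #|V|%:R * d by rewrite mulr_ge0.
rewrite -addn1 natrD mulrDl mul1r ler_norml; apply/andP; split; lra.
Qed.

End operations.

(** * Grid points *)

Section near_within_theory.
Context (R : realType) (V : finType) (K : simplicial_complex V).
Implicit Types p q s : realization R K.

Lemma near_withinC r p q : near_within r p q -> near_within r q p.
Proof. by move=> pq v; rewrite distrC. Qed.

Lemma near_within_le r r' p q : r <= r' -> near_within r p q -> near_within r' p q.
Proof. by move=> rr pq v; apply: le_trans rr. Qed.

Lemma near_within_trans q p s r r' :
  near_within r p q -> near_within r' q s -> near_within (r + r') p s.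
Proof.
move=> pq qs v; rewrite -(subrKA (q v)); apply: le_trans (ler_normD _ _) _.
exact: lerD.
Qed.

Lemma near_withinxx r p : 0 <= r -> near_within r p p.
Proof. by move=> r0 v; rewrite subrr normr0. Qed.

End near_within_theory.

Section grid_points.
Context (R : realType) (V : finType) (K : simplicial_complex V) (p0 : realization R K).
Local Notation T := (realization R K).

Definition grid_point z : T :=
  insubd p0 [ffun v => (gcoord z v)%:R / \sum_(w : V) (gcoord z w)%:R].

Lemma grid_supp M z : grid K M z -> [set v | (0 < gcoord z v)%N]%SET \in simplices K.
Proof.
case/and3P => _ _ /hasP[S]; rewrite mem_enum => SK /allP zS.
congr (_ \in simplices K): SK; apply/setP => v; rewrite inE.
by have := zS v (mem_enum _ v); case: (v \in S); case: (0 < gcoord z v)%N.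
Qed.

Lemma grid_pointE M z v : grid K M z -> grid_point z v = (gcoord z v)%:R / M%:R.
Proof.
move=> gz; rewrite /grid_point insubdK.
  by rewrite ffunE -natr_sum; case/and3P: gz => _ /eqP ->.
apply: in_realization_normalize => //.
by congr (_ \in simplices K): (grid_supp gz); apply/setP => w; rewrite !inE ltr0n.
Qed.

Lemma gcoord_code (k : V -> nat) v : gcoord (CodeSeq.code [seq k w | w <- enum V]) v = k v.
Proof.
by rewrite /gcoord CodeSeq.codeK (nth_map v) -?cardE// nth_enum_rank.
Qed.

Lemma grid_code M (k : V -> nat) : (\sum_v k v)%N = M ->
  [set v | (0 < k v)%N]%SET \in simplices K ->
  grid K M (CodeSeq.code [seq k w | w <- enum V]).
Proof.
move=> kM kK; apply/and3P; split.
- by rewrite CodeSeq.codeK size_map -cardE.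
- by under eq_bigr do rewrite gcoord_code; rewrite kM.
- apply/hasP; exists [set v | (0 < k v)%N]%SET; first by rewrite mem_enum.
  by apply/allP => v _; rewrite gcoord_code inE.
Qed.

(* All coordinates but one are rounded down; the remaining one, chosen in the
   support, takes up the slack. *)
Lemma exists_grid_near M (p : T) : (0 < M)%N ->
  exists2 z, grid K M z & near_within (#|V|%:R / M%:R) p (grid_point z).
Proof.
move=> M0; have MR : 0 < M%:R :> R by rewrite ltr0n.
have [v0 pv0] : exists v0, v0 \in [set v | 0 < p v]%SET.
  apply/finset.set0Pn; apply: contraNneq (simplices_neq0 K) => <-; exact: coords_supp.
rewrite inE in pv0.
pose t v := Num.truncn (M%:R * p v); pose s := (\sum_(v | v != v0) t v)%N.
pose k v := if v == v0 then (M - s)%N else t v.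
have tv v : (t v)%:R <= M%:R * p v < (t v).+1%:R.
  by apply: truncn_itv; rewrite mulr_ge0// coords_ge0.
have sumMp : \sum_(v | v != v0) M%:R * p v = M%:R - M%:R * p v0.
  by rewrite -mulr_sumr -[M%:R in X in X - _]mulr1 -(coords_sum p) (bigD1 v0)//= mulrDr addrAC
    subrr add0r.
have sle : s%:R <= M%:R - M%:R * p v0.
  by rewrite -sumMp natr_sum; apply: ler_sum => v _; have /andP[] := tv v.
have sM : (s <= M)%N.
  by rewrite -(ler_nat R); apply: le_trans sle _; rewrite gerBl mulr_ge0// coords_ge0.
(* Each rounded coordinate loses less than 1. *)
have sge : M%:R - M%:R * p v0 <= s%:R + #|V|%:R.
  rewrite -sumMp natr_sum -sum1_card natr_sum [X in _ + X](bigD1 v0)//= addrCA.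
  apply: ler_wpDl => //; rewrite -big_split /=; apply: ler_sum => v _.
  by have /andP[_ /ltW] := tv v; rewrite -natr1.
have kM : (\sum_v k v)%N = M.
  rewrite (bigD1 v0)//= /k eqxx (eq_bigr t) ?subnK// => v; by case: eqP.
have kK : [set v | (0 < k v)%N]%SET \in simplices K.
  apply: (simplices_sub (coords_supp p)).
    apply/fintype.subsetP => v; rewrite !inE /k; case: eqP => [-> //|_] tv0.
    have /andP[tle _] := tv v; rewrite -(pmulr_rgt0 _ MR); apply: lt_le_trans tle.
    by rewrite ltr0n.
  apply: contra_eq_neq kM => k0; rewrite big1 ?(ltn_eqF M0)// => v _.
  by apply/eqP; rewrite -leqn0 leqNgt; have := finset.in_set0 v; rewrite -k0 inE => ->.
exists (CodeSeq.code [seq k w | w <- enum V]); first exact: grid_code.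
move=> v; rewrite (grid_pointE _ (grid_code kM kK)) gcoord_code.
have -> : p v = M%:R * p v / M%:R by rewrite mulrAC divff ?mul1r// gt_eqF.
rewrite -mulrBl normrM normfV (ger0_norm (ltW MR)) ler_pM2r ?invr_gt0//.
have V1 : 1 <= #|V|%:R :> R by rewrite ler1n; apply/card_gt0P; exists v0.
rewrite /k ler_norml; case: eqP => [->|_].
  by rewrite natrB//; apply/andP; split; lra.
by have /andP[t1] := tv v; rewrite -natr1 => t2; apply/andP; split; lra.
Qed.

Lemma close_codesP M c k z w : grid K M z -> grid K M w -> (0 < M)%N -> (0 < c)%N ->
  reflect (near_within (k%:R / (c%:R * M%:R)) (grid_point z) (grid_point w))
    (close_codes V c k z w).
Proof.
move=> gz gw M0 c0.
have MR : 0 < M%:R :> R by rewrite ltr0n.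
have cR : 0 < c%:R :> R by rewrite ltr0n.
have E a b : ((c * a <= c * b + k)%N) = (a%:R / M%:R - b%:R / M%:R <= k%:R / (c%:R * M%:R) :> R).
  rewrite -mulrBl ler_pdivlMr ?mulr_gt0// mulrCA divfK ?gt_eqF//.
  by rewrite mulrBr lerBlDl -!natrM -natrD ler_nat.
apply: (iffP allP) => [cl v|nw v _].
  have /andP[] := cl v (mem_enum _ v); rewrite !E !(grid_pointE _ gz) !(grid_pointE _ gw).
  by move=> h1 h2; rewrite ler_norml lerNl opprB h2 h1.
have := nw v; rewrite !E (grid_pointE _ gz) (grid_pointE _ gw) ler_norml lerNl opprB.
by move=> /andP[-> ->].
Qed.

End grid_points.

(** Arguments have smaller codes than the term, so if the term has code c+1 they are all within
    [a c], and one application moves to [a c.+1]. This serves both directions, with [F] interpolated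
    from the table or [F] the algebra the table was read from. *)
Lemma term_op_near (R : realType) (V : finType) (K : simplicial_complex V) ar n
    (F : algebra ar (realization R K)) (f : algebra ar nat) (good : nat -> Prop)
    (pt : nat -> realization R K) (a : nat -> R) :
  (forall j, (j < n)%N -> a j <= a j.+1) ->
  (forall i z, (i < n)%N -> (forall l, good (z l)) -> good (f i z)) ->
  (forall i j y z, (i < n)%N -> (j < n)%N -> (forall l, good (z l)) ->
     (forall l, near_within (a j) (y l) (pt (z l))) ->
     near_within (a j.+1) (F i y) (pt (f i z))) ->
  forall (s : term ar) b g, (term_code s < n)%N -> (forall k, (k < n)%N -> good (g k)) ->
    (forall k, (k < n)%N -> near_within (a 0) (b k) (pt (g k))) ->
    good (term_op f s g) /\
    near_within (a (term_code s)) (term_op F s b) (pt (term_op f s g)).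
Proof.
move=> amono fgood Ff s b g + ggood bg.
have ale j k : (j <= k)%N -> (k <= n)%N -> a j <= a k.
  move=> jk; rewrite -(subnK jk); elim: (k - j)%N => [//|m IH]; rewrite addSn => mn.
  by apply: le_trans (IH (ltnW mn)) (amono _ mn).
elim: s => [k|i args IH] sn.
  have kn := ltn_trans (term_code_var ar k) sn; split; first exact: ggood.
  by apply: near_within_le (bg k kn); apply: ale => //; exact: ltnW.
have argn l := ltn_trans (term_code_arg args l) sn.
have i_n := ltn_trans (term_code_symbol args) sn.
have [c cE] : exists c, term_code (App args) = c.+1.
  by have := term_code_symbol args; case: (term_code _) => // c; exists c.
split; first by apply: fgood => // l; have [] := IH l (argn l).
have cn : (c < n)%N by apply: leq_trans (ltnW sn); rewrite cE.
rewrite cE; apply: Ff => // l; have [ogood onear] := IH l (argn l) => //.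
apply: near_within_le onear; apply: ale; last exact: ltnW.
by rewrite -ltnS -cE; exact: term_code_arg.
Qed.

(** * From tables to continuous algebras *)

Lemma mem_iota_lt i n : (i < n)%N -> i \in iota 0 n.
Proof. by rewrite mem_iota. Qed.

Section tables.
Context (R : realType) (ar : nat -> nat) (V : finType) (K : simplicial_complex V)
  (p0 : realization R K).
Local Notation T := (realization R K).
Local Notation pt := (grid_point p0).

Lemma nth_enum_map m (args : 'I_m -> nat) (l : 'I_m) :
  nth 0%N [seq args j | j <- enum 'I_m] l = args l.
Proof. by rewrite (nth_map l) ?size_enum_ord// nth_ord_enum. Qed.

Lemma decode_args m z : size (CodeSeq.decode z) = m ->
  [seq nth 0%N (CodeSeq.decode z) (nat_of_ord j) | j <- enum 'I_m] = CodeSeq.decode z.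
Proof.
move=> sz; apply: (@eq_from_nth _ 0%N); rewrite size_map size_enum_ord// => l lm.
by rewrite (nth_enum_map _ (Ordinal lm)).
Qed.

Lemma grid_tuple_code M m (args : 'I_m -> nat) : (forall l, grid K M (args l)) ->
  grid_tuple K M m (CodeSeq.code [seq args j | j <- enum 'I_m]).
Proof.
move=> ga; rewrite /grid_tuple CodeSeq.codeK size_map size_enum_ord eqxx /=.
by apply/allP => _ /mapP[l _ ->].
Qed.

Lemma grid_tuple_nth M m z l : grid_tuple K M m z -> (l < m)%N ->
  grid K M (nth 0%N (CodeSeq.decode z) l).
Proof. by move=> /andP[/eqP sz /allP zg] lm; apply: zg; rewrite mem_nth// sz. Qed.

Lemma tab_totalP n M tab :
  reflect (forall i (args : 'I_(ar i) -> nat), (i < n)%N -> (forall l, grid K M (args l)) ->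
             grid K M (tab_algebra tab args))
          (tab_total ar K n M tab).
Proof.
apply: (iffP allP) => [tot i args i_n ga|tot i]; last first.
  rewrite mem_iota leq0n add0n andTb => i_n; apply/allP => z _; apply/implyP => gz.
  have := tot i (fun l => nth 0%N (CodeSeq.decode z) l) i_n
    (fun l => grid_tuple_nth gz (ltn_ord l)).
  by rewrite /tab_algebra decode_args//; case/andP: gz => /eqP.
have /allP tot_i := tot i (mem_iota_lt i_n).
have gz := grid_tuple_code ga.
have := tot_i _ (mem_iota_lt (grid_tuple_lt gz)).
by rewrite gz CodeSeq.codeK.
Qed.

Lemma tab_continuousP n M tab A : (0 < M)%N -> tab_total ar K n M tab ->
  reflect (forall i j (z w : 'I_(ar i) -> nat), (i < n)%N -> (j < n)%N ->
    (forall l, grid K M (z l)) -> (forall l, grid K M (w l)) ->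
    (forall l, near_within ((2 * nth 0 A j)%N%:R / M%:R) (pt (z l)) (pt (w l))) ->
    near_within ((nth 0 A j.+1)%:R / (#|V|.+2%:R * M%:R)) (pt (tab_algebra tab z))
      (pt (tab_algebra tab w)))
   (tab_continuous ar K n M tab A).
Proof.
move=> M0 /tab_totalP tot; apply: (iffP allP) => [ct i j z w i_n jn gz gw zw|ct i]; last first.
  rewrite mem_iota leq0n add0n andTb => i_n; apply/allP => z _; apply/allP => w _.
  apply/implyP => /andP[gz gw]; apply/allP => j; rewrite mem_iota /= => jn.
  apply/implyP => /allP zw.
  pose args x (l : 'I_(ar i)) := nth 0%N (CodeSeq.decode x) l.
  have gargs x : grid_tuple K M (ar i) x -> forall l, grid K M (args x l).
    by move=> gx l; exact: grid_tuple_nth gx (ltn_ord l).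
  have appE x : grid_tuple K M (ar i) x -> tab_app tab i (CodeSeq.decode x) = tab_algebra tab
    (args x).
    by case/andP=> /eqP sx _; rewrite /tab_algebra decode_args.
  rewrite !appE//; apply/(close_codesP p0 (M := M)) => //; try exact: tot (gargs _ _).
  apply: ct => // [||l]; try exact: gargs.
  have := zw l (mem_iota_lt (ltn_ord l)).
  by move/(close_codesP p0 _ (gargs _ gz l) (gargs _ gw l) M0 (ltn0Sn _)); rewrite mul1r.
have /allP ct_i := ct i (mem_iota_lt i_n).
have tz := grid_tuple_code gz; have tw := grid_tuple_code gw.
have /allP ct_z := ct_i _ (mem_iota_lt (grid_tuple_lt tz)).
have := ct_z _ (mem_iota_lt (grid_tuple_lt tw)).
rewrite tz tw /= !CodeSeq.codeK => /allP/(_ j (mem_iota_lt jn))/implyP H.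
apply/(close_codesP p0 _ (tot i z i_n gz) (tot i w i_n gw)) => //; apply: H.
apply/allP => l; rewrite mem_iota /= !CodeSeq.codeK => lm.
rewrite !(nth_enum_map _ (Ordinal lm)).
by apply/(close_codesP p0 _ (gz _) (gw _) M0 (ltn0Sn _)); rewrite mul1r; exact: zw.
Qed.

Lemma moduliP n x M A : moduli V n x M A ->
  [/\ (#|V| < nth 0 A 0)%N, forall j k, (j <= k <= n)%N -> (nth 0 A j <= nth 0 A k)%N &
      (x.+1 * nth 0 A n <= M)%N].
Proof.
case/and3P => V0 /allP mono An; split=> // j k /andP[jk].
rewrite -(subnK jk); elim: (k - j)%N => [//|m IH]; rewrite addSn => mn.
by apply: leq_trans (IH (ltnW mn)) (mono _ _); rewrite mem_iota.
Qed.

Lemma tab_operation n x M tab A i : moduli V n x M A -> tab_total ar K n M tab ->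
    tab_continuous ar K n M tab A ->
  exists2 F : ('I_(ar i) -> T) -> T, continuous (F : {ptws 'I_(ar i) -> T} -> T) &
    forall j y (z : 'I_(ar i) -> nat), (i < n)%N -> (j < n)%N ->
      (forall l, grid K M (z l)) ->
      (forall l, near_within ((nth 0 A j)%:R / M%:R) (y l) (pt (z l))) ->
      near_within ((nth 0 A j.+1)%:R / M%:R) (F y) (pt (tab_algebra tab z)).
Proof.
move=> /moduliP[V0 mono An] tot ct.
(* Symbols of index at least n do not occur in the equations and are interpreted by a constant. *)
case: (ltnP i n) => [i_n|]; last by exists (fun=> p0) => //; exact: cst_continuous.
have n0 : (0 < n)%N by exact: leq_ltn_trans i_n.
have M0 : (0 < M)%N.
  by apply: leq_trans An; rewrite muln_gt0 /=; apply: leq_trans (mono 0%N n _); lia.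
have MR : 0 < M%:R :> R by rewrite ltr0n.
have /tab_continuousP := ct => /(_ M0 tot) ctP; have /tab_totalP totP := tot.
pose D : R := #|V|.+2%:R; have D0 : 0 < D by rewrite ltr0n.
pose al j : R := (nth 0 A j)%:R / M%:R.
have al_le j k : (j <= k <= n)%N -> al j <= al k.
  by move=> jk; rewrite ler_pM2r ?invr_gt0// ler_nat mono.
have divE j : (nth 0 A j)%:R / (D * M%:R) = al j / D by rewrite /al invfM mulrA mulrAC.
pose C := (CodeSeq.code (nseq #|V| M)).+1.
pose G : finType := {z : 'I_C | grid K M z}.
(* The partition of unity is indexed by tuples of grid points, with radius [al 0] and variation
   [al 1 / D]. *)
pose I : finType := {ffun 'I_(ar i) -> G}.
pose idx (g : I) (l : 'I_(ar i)) : nat := val (val (g l)).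
have gidx g l : grid K M (idx g l) by exact: valP (g l).
have h0 : 0 < al 0 by rewrite divr_gt0// ltr0n; exact: leq_ltn_trans V0.
have al1 j : (j <= n)%N -> al j <= 1.
  move=> jn; rewrite ler_pdivrMr// mul1r ler_nat; apply: leq_trans An.
  by apply: leq_trans (mono j n _) _; rewrite ?jn//=; exact: leq_pmull.
have d0 : 0 <= al 1 / D by rewrite divr_ge0 ?ltW// divr_gt0// ltr0n;
  apply: leq_trans (mono 0%N 1%N _); lia.
have Vd : #|V|%:R * (al 1 / D) < 1.
  rewrite mulrA ltr_pdivrMr// mul1r; apply: (@le_lt_trans _ _ #|V|%:R).
    by rewrite ler_piMr// al1.
  by rewrite ltr_nat.
have net (y : 'I_(ar i) -> T) : exists g : I, forall l v, `|y l v - pt (idx g l) v| < al 0.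
  have H l : exists z : G, near_within (#|V|%:R / M%:R) (y l) (pt (val (val z))).
    have [z gz yz] := exists_grid_near p0 (y l) M0.
    have zC : (z < C)%N by rewrite ltnS; exact: grid_leq gz.
    by exists (exist _ (Ordinal zC) gz).
  have [g gP] := choice H; exists (finfun g) => l v; rewrite /idx ffunE.
  by apply: le_lt_trans (gP l v) _; rewrite ltr_pM2r ?invr_gt0// ltr_nat.
have cont g g' : (forall l, near_within (2 * al 0) (pt (idx g l)) (pt (idx g' l))) ->
    near_within (al 1 / D) (pt (tab_algebra tab (idx g))) (pt (tab_algebra tab (idx g'))).
  move=> gg'; rewrite -divE; apply: ctP => // l.
  by rewrite natrM -mulrA; exact: gg'.
have [F cF FP] := interpolation p0 h0 d0 Vd net cont.
exists F => // j y z _ jn gz yz.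
apply: (near_within_le (r := al j.+1 / D + #|V|.+1%:R * (al 1 / D))); last first.
  apply: FP => g yg; rewrite -divE; apply: ctP => // l.
  (* An active grid tuple is within [al 0] of y and y is within [al j] of z, which explains the
     factor 2 in the table check. *)
  apply: (near_within_le (r := al 0 + al j)).
    by rewrite natrM -mulrA -/(al j) [2%:R]/(1 + 1) mulrDl mul1r lerD2r al_le//= ltnW.
  by apply: near_within_trans (near_withinC _) (yz l).
apply: (@le_trans _ _ (al j.+1 / D + #|V|.+1%:R * (al j.+1 / D))).
  by rewrite lerD2l ler_wpM2l// ler_pM2r ?invr_gt0// al_le// jn.
by rewrite -{1}[al j.+1 / D]mul1r -mulrDl nat1r mulrCA divff ?mulr1// gt_eqF.
Qed.

(** Each side of an equation is within A_n / M <= 1/(x+1) of its table value, and the two table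
    values are within 1/(x+1): hence 3. The factor |V| passes to the Euclidean distance. *)
Lemma sound_approx n x M tab A : approx_satisfied ar K n x M tab A ->
  (lambda_space T (@coded_set ar n) <= (#|V|%:R * (3 / x.+1%:R))%:E :> \bar R)%E.
Proof.
move=> /and4P[mod tot ct /allP sat].
have [V0 mono An] := moduliP mod.
have M0 : (0 < M)%N.
  by apply: leq_trans An; rewrite muln_gt0 /=; apply: leq_trans (mono 0%N n _); lia.
have MR : 0 < M%:R :> R by rewrite ltr0n.
have xR : 0 < x.+1%:R :> R by rewrite ltr0n.
have H i := cid2 (tab_operation i mod tot ct).
pose F : algebra ar T := fun i => s2val (H i).
have FP i := s2valP' (H i).
have cF : continuous_algebra F by move=> i; exact: (s2valP (H i)).
apply: (@le_trans _ _ (lambda_algebra F (@coded_set ar n))).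
  by apply: ereal_inf_lbound; exists F.
apply: ge_ereal_sup => _ [->|[e [b [ne ->]]]]; first by rewrite lee_fin mulr_ge0// divr_ge0.
have en := bit_lt ne.
rewrite lee_fin; apply: mdist_near_within; last by rewrite divr_ge0.
have [g gP] := choice (fun k => let: ex_intro2 z gz bz := exists_grid_near p0 (b k) M0 in
  ex_intro (fun z => grid K M z /\ near_within (#|V|%:R / M%:R) (b k) (pt z)) z (conj gz bz)).
pose a k : R := (nth 0 A k)%:R / M%:R.
have a_le j k : (j <= k <= n)%N -> a j <= a k.
  by move=> jk; rewrite ler_pM2r ?invr_gt0// ler_nat mono.
have an : a n <= 1 / x.+1%:R.
  by rewrite ler_pdivrMr// mulrAC ler_pdivlMr// mul1r mulrC -natrM ler_nat.
(* The rounded assignment is cut to n entries to be one of the tuples the check runs over. *)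
pose g' := nth 0%N (mkseq g n).
have key (s : term ar) : (term_code s < n)%N -> grid K M (term_op (tab_algebra tab) s g') /\
    near_within (1 / x.+1%:R) (term_op F s b) (pt (term_op (tab_algebra tab) s g')).
  move=> sn; have [|||||ok nr] := @term_op_near R V K ar n F (tab_algebra tab) (grid K M) pt a
    _ _ _ s b g' sn.
  - by move=> j jn; apply: a_le; rewrite leqnSn.
  - by move=> i z i_n gz; move/tab_totalP: tot; apply.
  - by move=> i j y z i_n jn gz yz; apply: FP.
  - by move=> k kn; rewrite /g' nth_mkseq//; have [] := gP k.
  - move=> k kn; rewrite /g' nth_mkseq//; have [_] := gP k; apply: near_within_le.
    by rewrite ler_pM2r ?invr_gt0// ler_nat ltnW.
  by split=> //; apply: near_within_le nr; apply: le_trans an; apply: a_le; rewrite leqnn ltnW.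
have [gl nl] := key _ (ltn_trans (equation_code_l e) en).
have [gr nr] := key _ (ltn_trans (equation_code_r e) en).
have := sat _ (mem_iota_lt en); rewrite -/(bit n _) ne /= => /andP[_ /allP sate].
have ta : grid_tuple K M n (CodeSeq.code (mkseq g n)).
  rewrite /grid_tuple CodeSeq.codeK size_mkseq eqxx /=.
  by apply/allP => _ /mapP[k _ ->]; have [] := gP k.
have := sate _ (mem_iota_lt (grid_tuple_lt ta)).
rewrite ta CodeSeq.codeK decode_equation !code_eval_term /=.
move=> /(close_codesP p0 _ gl gr M0 (ltn0Sn _)); rewrite mulrC invfM divfK ?gt_eqF// => nlr.
have -> : 3 / x.+1%:R = 1 / x.+1%:R + (x.+1%:R^-1 + 1 / x.+1%:R) :> R.
  by rewrite div1r; move: (_^-1) => t; lra.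
apply: near_within_trans nl (near_within_trans nlr (near_withinC nr)).
Qed.

End tables.

(** * From continuous algebras to tables *)

Section completeness.
Context (R : realType) (ar : nat -> nat) (V : finType) (K : simplicial_complex V)
  (p0 : realization R K).
Local Notation T := (realization R K).
Local Notation pt := (grid_point p0).

Lemma common_modulus n (F : algebra ar T) (e e' : R) : continuous_algebra F ->
  0 < e -> 0 < e' ->
  exists2 d : R, 0 < d <= e & forall i y z, (i < n)%N ->
    (forall l, near_within d (y l) (z l)) -> near_within e' (F i y) (F i z).
Proof.
move=> cF e0 e'0; elim: n => [|n [d /andP[d0 de] dP]]; first by exists e; rewrite ?e0/=.
have [c c0 cP] := uniform_continuity (cF n) e'0.
exists (Num.min c d); first by rewrite lt_min c0 d0 ge_min de orbT.
move=> i y z; rewrite ltnS leq_eqVlt => /predU1P[i_n|i_n] yz.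
  subst i; by apply: cP => l; apply: near_within_le (yz l); rewrite ge_min lexx.
by apply: dP => // l; apply: near_within_le (yz l); rewrite ge_min lexx orbT.
Qed.

(** The chain is built downwards from [a n = e], each member from the next one by uniform
    continuity; [a j] is therefore the (n - j)-th iterate. *)
Lemma exists_moduli n (F : algebra ar T) (e c : R) : continuous_algebra F ->
  0 < e -> 0 < c -> exists a : nat -> R,
  [/\ a n = e, forall j, 0 < a j, forall j, (j < n)%N -> a j <= a j.+1 &
    forall i j y z, (i < n)%N -> (j < n)%N ->
      (forall l, near_within (2 * a j) (y l) (z l)) ->
      near_within (c * a j.+1) (F i y) (F i z)].
Proof.
move=> cF e0 c0.
(* The guard [0 < r] sits inside the existential so that choice yields a total function to
   iterate. *)
have H (r : R) : exists d : R, 0 < r -> 0 < d <= r /\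
    forall i y z, (i < n)%N -> (forall l, near_within (2 * d) (y l) (z l)) ->
      near_within (c * r) (F i y) (F i z).
  case: (ltP 0 r) => [r0|]; last by exists 0.
  have [d /andP[d0 dr] dP] := common_modulus n cF r0 (mulr_gt0 c0 r0).
  exists (d / 2) => _; split; first by apply/andP; split; lra.
  by rewrite mulrC divfK.
have [phi phiP] := choice H.
have it0 k : 0 < iter k phi e by elim: k => //= k /phiP[/andP[]].
exists (fun j => iter (n - j) phi e); split => //; first by rewrite subnn.
  by move=> j jn; rewrite -(subnSK jn) /=; have [/andP[]] := phiP _ (it0 (n - j.+1)%N).
move=> i j y z i_n jn; rewrite -(subnSK jn) /=; have [_] := phiP _ (it0 (n - j.+1)%N).
by apply.
Qed.

Lemma exists_table n M (u : forall i, ('I_(ar i) -> nat) -> nat) : exists tab : seq nat,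
  forall i (args : 'I_(ar i) -> nat), (i < n)%N -> (forall l, grid K M (args l)) ->
    tab_algebra tab args = u i args.
Proof.
pose val c := u (head 0%N (CodeSeq.decode c))
  (fun l => nth 0%N (behead (CodeSeq.decode c)) (nat_of_ord l)).
(* The length exceeds the index 2 ^ i (2 c + 1) of every entry with i < n and grid arguments of code
   c. *)
exists (mkseq val (\max_(i < n) (2 ^ i * (tuple_bound V M (ar i)).*2.+1)).+1).
move=> i args i_n ga; rewrite /tab_algebra /tab_app nth_mkseq.
  rewrite /val CodeSeq.codeK /=; congr u; apply/funext => l; exact: nth_enum_map.
rewrite ltnS; apply: leq_trans (leq_bigmax (Ordinal i_n)).
rewrite -[leqLHS]/(2 ^ i * (CodeSeq.code [seq args j | j <- enum 'I_(ar i)]).*2.+1)%N.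
by rewrite leq_mul2l ltnS leq_double (ltnW (grid_tuple_lt (grid_tuple_code ga))) orbT.
Qed.

Lemma complete_approx n x : (forall k, bit n k -> wf_equation ar k) ->
  lambda_space T (@coded_set ar n) = 0%E ->
  exists M tab A, approx_satisfied ar K n x M tab A.
Proof.
move=> wf lam0; pose X : R := x.+1%:R; have X0 : 0 < X by rewrite ltr0n.
(* Three errors [eps] add up in the final comparison and must stay below 1 / X. *)
pose eps : R := (4 * X)^-1; have eps0 : 0 < eps by rewrite invr_gt0 mulr_gt0.
have : (lambda_space T (@coded_set ar n) < eps%:E)%E by rewrite lam0 lte_fin.
move=> /ereal_inf_lt[_ [F cF <-] lF].
have Feq (e : equation ar) b : bit n (equation_code e) ->
    near_within eps (term_op F e.1 b) (term_op F e.2 b).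
  move=> ne; apply: near_within_le (coord_le_mdist _ _); apply: ltW; rewrite -lte_fin.
  by apply: le_lt_trans lF; apply: ereal_sup_ubound; right; exists e, b.
pose d : R := #|V|%:R; have d0 : 0 <= d by [].
pose D : R := #|V|.+2%:R; have DE : D = d + 2 by rewrite /D /d -natr1 -natr1; lra.
have D0 : 0 < D by rewrite ltr0n.
(* The table must vary by at most A_(j+1) / (D M), roughly [a j.+1 / D]. Half of this goes to the
   variation of F, the other half to rounding. *)
have c0 : 0 < (2 * D)^-1 by rewrite invr_gt0 mulr_gt0.
have [a [an a0 amono aF]] := exists_moduli n cF eps0 c0.
have a_le j k : (j <= k)%N -> (k <= n)%N -> a j <= a k.
  move=> jk; rewrite -(subnK jk); elim: (k - j)%N => [//|m IH]; rewrite addSn => mn.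
  by apply: le_trans (IH (ltnW mn)) (amono _ mn).
(* Rounding two values costs 2 d D after scaling by D M, and truncating the modulus costs 1; both
   fit into half of M a_(j+1) as soon as M a_(j+1) > 4 d D + 2. *)
pose C := 4 * d * D + 2.
have C0 : 0 < C by rewrite /C; have := mulr_ge0 d0 (ltW D0); nra.
pose M := (Num.truncn (C / a 0%N)).+1.
have M0 : (0 < M)%N by [].
have MR : 0 < M%:R :> R by rewrite ltr0n.
have Ma0 : C < M%:R * a 0%N by rewrite -ltr_pdivrMr//; exact: truncnS_gt.
have Ma j : (j <= n)%N -> C < M%:R * a j.
  by move=> jn; apply: lt_le_trans Ma0 _; rewrite ler_pM2l// a_le.
have dM j : (j <= n)%N -> d / M%:R <= a j / 2.
  move=> /Ma aj; rewrite ler_pdivrMr// mulrAC ler_pdivlMr// [_ * M%:R]mulrC.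
  apply: le_trans (ltW aj); rewrite /C; nra.
pose A := mkseq (fun j => Num.truncn (M%:R * a j)) n.+1.
have AE j : (j <= n)%N -> nth 0%N A j = Num.truncn (M%:R * a j) by move=> jn; rewrite nth_mkseq.
have Abnd j : (j <= n)%N -> (nth 0%N A j)%:R <= M%:R * a j < (nth 0%N A j)%:R + 1.
  by move=> jn; rewrite AE// natr1; apply: truncn_itv; rewrite mulr_ge0// ltW.
have AM j : (j <= n)%N -> (nth 0%N A j)%:R / M%:R <= a j.
  by move=> jn; rewrite ler_pdivrMr// mulrC; have /andP[] := Abnd j jn.
have [rnd rndP] := choice (fun p => let: ex_intro2 z gz pz := exists_grid_near p0 p M0 in
  ex_intro (fun z => grid K M z /\ near_within (#|V|%:R / M%:R) p (pt z)) z (conj gz pz)).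
have rg p : grid K M (rnd p) by have [] := rndP p.
have rn p : near_within (d / M%:R) p (pt (rnd p)) by have [] := rndP p.
(* The table holds the values of F at grid points, rounded back to the grid. *)
have [tab tabE] := exists_table n M (fun i args => rnd (F i (fun l => pt (args l)))).
have tot : tab_total ar K n M tab by apply/tab_totalP => i args i_n ga; rewrite tabE.
exists M, tab, A; apply/and4P; split => //.
- apply/and3P; split.
  + rewrite AE// truncn_gt_nat; apply: le_trans (ltW Ma0).
    rewrite -natr1 -/d /C DE; nra.
  + apply/allP => j; rewrite mem_iota leq0n add0n andTb => jn; rewrite !AE//; last exact: ltnW.
    by apply: le_truncn; rewrite ler_pM2l// amono.
  + rewrite -(ler_nat R) natrM -/X.
    have /andP[+ _] := Abnd n (leqnn n); rewrite an /eps ler_pdivlMr ?mulr_gt0// => AX.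
    have : 0 <= (nth 0%N A n)%:R * X by rewrite mulr_ge0// ltW.
    nra.
- apply/(tab_continuousP p0 _ M0 tot) => i j z w i_n jn gz gw zw; rewrite !tabE//.
  have Fzw : near_within ((2 * D)^-1 * a j.+1) (F i (fun l => pt (z l))) (F i (fun l =>
    pt (w l))).
    apply: aF => // l; apply: near_within_le (zw l).
    by rewrite natrM -mulrA ler_pM2l// AM// ltnW.
  apply: near_within_le (near_within_trans (near_withinC (rn _)) (near_within_trans Fzw (rn _))).
  rewrite ler_pdivlMr ?mulr_gt0//.
  have -> : (d / M%:R + ((2 * D)^-1 * a j.+1 + d / M%:R)) * (D * M%:R) =
      2 * (d * D) + M%:R * a j.+1 / 2.
    by field; rewrite !gt_eqF.
  by have /andP[_] := Abnd j.+1 jn; have := Ma j.+1 jn; rewrite /C; lra.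
apply/allP => k; rewrite mem_iota /= => kn; apply/implyP => nk; rewrite wf//=.
have /wf_equationP[e ek] := wf k nk.
apply/allP => g _; apply/implyP => gg.
have e_n : (equation_code e < n)%N by rewrite ek.
pose b k := pt (nth 0%N (CodeSeq.decode g) k).
have key (s : term ar) : (term_code s < n)%N ->
    grid K M (term_op (tab_algebra tab) s (nth 0%N (CodeSeq.decode g))) /\
    near_within eps (term_op F s b) (pt (term_op (tab_algebra tab) s (nth 0%N (CodeSeq.decode
      g)))).
  move=> sn; have [|||||ok nr] := @term_op_near R V K ar n F (tab_algebra tab) (grid K M) pt a
    _ _ _ s b (nth 0%N (CodeSeq.decode g)) sn.
  - by move=> j jn; exact: amono.
  - by move=> i z i_n gz; rewrite tabE.
  - move=> i j y z i_n jn gz yz; rewrite tabE//.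
    have Fyz : near_within ((2 * D)^-1 * a j.+1) (F i y) (F i (fun l => pt (z l))).
      apply: aF => // l; apply: near_within_le (yz l); have := a0 j; lra.
    apply: near_within_le (near_within_trans Fyz (rn _)).
    have Da : (2 * D)^-1 * a j.+1 <= a j.+1 / 2.
      rewrite mulrC ler_pM2l ?a0// lef_pV2 ?posrE ?mulr_gt0//; lra.
    by apply: le_trans (lerD Da (dM j.+1 jn)) _; rewrite -splitr.
  - by move=> l ln; exact: grid_tuple_nth gg ln.
  - by move=> l ln; apply: near_withinxx; exact: ltW.
  by split=> //; rewrite -an; apply: near_within_le nr; apply: a_le => //; exact: ltnW.
rewrite /= -ek decode_equation !code_eval_term /=.
have [gl nl] := key _ (ltn_trans (equation_code_l e) e_n).
have [gr nr] := key _ (ltn_trans (equation_code_r e) e_n).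
apply/(close_codesP p0 _ gl gr M0 (ltn0Sn _)).
have ne : bit n (equation_code e) by rewrite ek.
apply: near_within_le (near_within_trans (near_withinC nl) (near_within_trans (Feq e b ne) nr)).
rewrite invfM mulrA mulrAC divff ?mul1r ?gt_eqF// -/X /eps invfM.
have : 0 < X^-1 by rewrite invr_gt0.
by move: (X^-1) => t t0; lra.
Qed.

End completeness.

(** * The empty complex, the limit over all precisions, and the equivalence *)

Lemma realization_vertex (R : realType) (V : finType) (K : simplicial_complex V) (v : V) :
  inhabited (realization R K).
Proof.
pose N w : R := (w == v)%:R.
suff NK : in_realization K [ffun w => N w / \sum_w N w] by exact: inhabits (Realization NK).
apply: in_realization_normalize => [w|]; first exact: ler0n.
have : v \in finset.cover (simplices K) by rewrite (simplices_cover K) finset.in_setT.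
move=> /finset.bigcupP[S SK vS]; apply: (simplices_sub SK).
  by apply/fintype.subsetP => w; rewrite inE ltr0n lt0b => /eqP ->.
by apply/finset.set0Pn; exists v; rewrite inE /N eqxx.
Qed.

(** Without vertices no coordinates sum to 1, so the space is empty and a nullary symbol has no
    interpretation: the infimum is over no algebras. *)
Lemma lambda_space_empty (R : realType) (V : finType) (K : simplicial_complex V) ar i
    (Sigma : set (equation ar)) :
  #|V| = 0%N -> ar i = 0%N -> lambda_space (realization R K) Sigma = +oo%E.
Proof.
move=> V0 i0; rewrite /lambda_space (_ : [set _ | _ in _] = set0) ?ereal_inf0//.
apply/seteqP; split=> // y [F _ _].
have [args] : inhabited ('I_(ar i) -> realization R K).
  by rewrite i0; constructor; case=> m m0; exfalso; rewrite ltn0 in m0.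
have := coords_sum (F i args).
rewrite big1 => [|v _]; first by move/eqP; rewrite eq_sym oner_eq0.
by have := card0_eq V0 v; rewrite inE.
Qed.

Lemma lambda_space_eq0 (R : realType) (V : finType) (K : simplicial_complex V) ar
    (Sigma : set (equation ar)) (c : R) : 0 <= c ->
  (forall x : nat, lambda_space (realization R K) Sigma <= (c * (3 / x.+1%:R))%:E)%E ->
  lambda_space (realization R K) Sigma = 0%E.
Proof.
move=> c0 le; apply/eqP; rewrite eq_le; apply/andP; split; last first.
  by apply: le_ereal_inf_tmp => _ [F _ <-]; apply: ereal_sup_ubound; left.
apply/lee_addgt0Pr => e e0; rewrite add0e.
apply: le_trans (le (Num.truncn (c * 3 / e))) _; rewrite lee_fin mulrA.
by rewrite ler_pdivrMr// [e * _]mulrC -ler_pdivrMr// ltW// truncnS_gt.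
Qed.

Theorem corollary40 (R : realType) (ar : nat -> nat)
    (ar_recursive : recursive (fun v : 1.-tuple nat => ar (thead v)))
    (ar_infinite : forall n : nat, infinite_set [set i : nat | ar i = n])
    (V : finType) (K : simplicial_complex V) :
  Pi2 [set finset_code Sigma | Sigma in
        [set Sigma : set (equation ar) |
           finite_set Sigma /\ lambda_space (realization R K) Sigma = 0%E]].
Proof.
case: (posnP #|V|) => [V0|/card_gt0P[v _]].
  (* No Sigma qualifies on the empty space, so the constantly false relation defines the set. *)
  have /infinite_setN0[i i0] := ar_infinite 0%N.
  exists (fun _ : 3.-tuple nat => false); split; first exact: (recursive_zero 3).
  move=> n; split=> [[Sigma [_]]|/(_ 0%N)[]//].
  by rewrite (lambda_space_empty _ _ _ V0 i0).
have [p0] := realization_vertex R K v.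
exists (fun u : 3.-tuple nat =>
  witnessed ar K (nth 0%N u 0) (nth 0%N u 1) (nth 0%N u 2)); split.
  exact: (recB_witnessed K ar_recursive).
move=> n; split=> [/image_finset_code[wf lam0] x|H].
  have [M [tab [A app]]] := complete_approx p0 x wf lam0.
  exists (CodeSeq.code [:: M; CodeSeq.code tab; CodeSeq.code A]).
  rewrite -[is_true _]/(is_true (witnessed ar K n x (CodeSeq.code _))) /witnessed CodeSeq.codeK.
  by rewrite -[nth 0 _ 1]/(CodeSeq.code tab) -[nth 0 _ 2]/(CodeSeq.code A) !CodeSeq.codeK.
apply/image_finset_code; split=> [k nk|].
  (* Well-formedness of n does not involve the precision and can be read off at x = 0. *)
  have [y /and4P[_ _ _ /allP sat]] := H 0%N.
  have := sat k (mem_iota_lt (bit_lt nk)).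
  by rewrite -/(bit n k) nk => /andP[].
apply: (lambda_space_eq0 (ler0n R #|V|)) => x.
by have [y /(sound_approx p0)] := H x.
Qed.
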